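(* (1) Any finite abelian subgroup $F$ of $\mathrm{Spin}(12)$ satisfying condition $(\ast)$ and with $-1,c\in F$ (where $c=e_1e_2\cdots e_{12}$) is conjugate in $\mathrm{Spin}(12)$ to $$F_{12}=\langle -1,\,c,\,e_1e_2e_3e_4,\,e_1e_2e_5e_6,\,e_1e_2e_7e_8,\,e_1e_2e_9e_{10},\,e_1e_3e_5e_7e_9e_{11}\rangle.$$ (2) Any finite abelian subgroup $F$ of $\mathrm{Spin}(14)$ satisfying condition $(\ast)$ and with $-1,c\in F$ (where $c=e_1e_2\cdots e_{14}$) is conjugate in $\mathrm{Spin}(14)$ to $$F_{14}=\langle -1,\,c,\,e_1e_2e_3e_4,\,e_1e_2e_5e_6,\,e_1e_3e_5e_7,\,e_8e_9e_{10}e_{11},\,e_8e_9e_{12}e_{13},\,e_8e_{10}e_{12}e_{14}\rangle.$$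
   Context: $e_1,\dots,e_n$ is an orthonormal basis of Euclidean $n$-space and $\mathrm{Spin}(n)$ is realized inside the Clifford algebra ($e_i^2=-1$, $e_ie_j=-e_je_i$ for $i\neq j$). Condition $(\ast)$ for a closed abelian subgroup $F$ of a compact Lie group $G$ with Lie algebra $\mathfrak{g}_0$: $\dim\mathfrak{g}_0^F=\dim F$, where $\mathfrak{g}_0^F$ is the fixed subalgebra of the adjoint action of $F$. For $F$ finite in $\mathrm{Spin}(n)$ it says $\mathfrak{so}(n)^F=0$. *)

(* Defs.v *)
From HB Require Import structures.
From mathcomp Require Import all_boot all_order all_algebra all_field.
From mathcomp Require Import all_classical all_reals all_analysis.
Set Implicit Arguments.
Unset Strict Implicit.
Unset Printing Implicit Defensive.
Import Order.TTheory GRing.Theory Num.Theory.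
Import numFieldNormedType.Exports.
Local Open Scope classical_set_scope.
Local Open Scope ring_scope.

Definition symd (n : nat) (A B : {set 'I_n}) : {set 'I_n} :=
  [set i | (i \in A) (+) (i \in B)]%SET.

(* The sign with e_A e_B = cliff_sign A B *: e_(A symd B), where e_A denotes
   the product of the e_i, i in A, in increasing order. Each pair j < i costs
   one transposition of anticommuting generators, each common index i = j costs
   one relation e_i ^ 2 = -1. *)
Definition cliff_sign (R : realType) (n : nat) (A B : {set 'I_n}) : R :=
  \prod_(i in A) \prod_(j in B | (j <= i)%N) (-1).

(* The real Clifford algebra of Euclidean n-space (with e_i ^ 2 = -1): the
   vector space with basis (e_A), x A being the coordinate of x on e_A. *)
Definition cliff (R : realType) (n : nat) := {ffun {set 'I_n} -> R^o}.

HB.instance Definition _ (R : realType) (n : nat) :=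
  Vector.copy (cliff R n) {ffun {set 'I_n} -> R^o}.

Definition cliff_coef (R : realType) (n : nat) (A : {set 'I_n})
  (x : cliff R n) : R := (x : {ffun {set 'I_n} -> R^o}) A.

Definition cliff_mono (R : realType) (n : nat) (A : {set 'I_n}) : cliff R n :=
  [ffun B : {set 'I_n} => (B == A)%:R : R^o].

Definition cliff_mul (R : realType) (n : nat) (x y : cliff R n) : cliff R n :=
  [ffun C : {set 'I_n} => (\sum_(A : {set 'I_n})
     cliff_sign R A (symd A C) *
     (cliff_coef A x * cliff_coef (symd A C) y) : R^o)].

Section CliffRing.
Context {R : realType} {n : nat}.
Implicit Types (A B C : {set 'I_n}) (x y z : cliff R n).

Lemma symdC A B : symd A B = symd B A.
Proof. by apply/setP => i; rewrite !inE addbC. Qed.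

Lemma symdA A B C : symd A (symd B C) = symd (symd A B) C.
Proof. by apply/setP => i; rewrite !inE addbA. Qed.

Lemma symdK A B : symd A (symd A B) = B.
Proof. by apply/setP => i; rewrite !inE addbA addbb. Qed.

Lemma symd0 A : symd finset.set0 A = A.
Proof. by apply/setP => i; rewrite !inE. Qed.

Lemma prod_symd (P : pred 'I_n) A B (f : 'I_n -> R) :
    (forall i, f i * f i = 1) ->
  \prod_(i in symd A B | P i) f i =
  (\prod_(i in A | P i) f i) * \prod_(i in B | P i) f i.
Proof.
move=> ff; rewrite !(big_mkcond (fun i => _ && P i)) -big_split /=.
apply: eq_bigr => i _; rewrite inE.
by case: (i \in A) (i \in B) (P i) => [] [] []; rewrite /= ?ff ?mulr1 ?mul1r.
Qed.

Lemma cliff_sign_row_sq B (i : 'I_n) :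
  let f := \prod_(j in B | (j <= i)%N) (-1) : R in f * f = 1.
Proof.
move=> f; rewrite -big_split /= big1 // => j _.
by rewrite mulrNN mulr1.
Qed.

Lemma cliff_signDl A B C :
  cliff_sign R (symd A B) C = cliff_sign R A C * cliff_sign R B C.
Proof.
rewrite /cliff_sign.
have := prod_symd xpredT A B (cliff_sign_row_sq C).
by under eq_bigl do rewrite andbT; under [in RHS]eq_bigl do rewrite andbT;
   under [X in _ * X]eq_bigl do rewrite andbT.
Qed.

Lemma cliff_signDr A B C :
  cliff_sign R A (symd B C) = cliff_sign R A B * cliff_sign R A C.
Proof.
rewrite /cliff_sign -big_split /=; apply: eq_bigr => i _.
by apply: prod_symd => j; rewrite mulrNN mulr1.
Qed.

Lemma cliff_sign0l A : cliff_sign R finset.set0 A = 1.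
Proof. by rewrite /cliff_sign big_set0. Qed.

Lemma cliff_sign0r A : cliff_sign R A finset.set0 = 1.
Proof.
by rewrite /cliff_sign big1 // => i _; rewrite big_pred0 // => j; rewrite inE.
Qed.

Lemma cliffP x y : (forall A, cliff_coef A x = cliff_coef A y) -> x = y.
Proof. by move=> e; apply/ffunP => A; exact: e. Qed.

Lemma cliff_coefD A x y :
  cliff_coef A (x + y) = cliff_coef A x + cliff_coef A y.
Proof. by rewrite /cliff_coef ffunE. Qed.

Lemma cliff_coefZ A (a : R) x : cliff_coef A (a *: x) = a * cliff_coef A x.
Proof. by rewrite /cliff_coef ffunE. Qed.

Lemma cliff_coef_mono A B : cliff_coef A (cliff_mono R B) = (A == B)%:R.
Proof. by rewrite /cliff_coef ffunE. Qed.

Lemma cliff_coef_mul C x y :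
  cliff_coef C (cliff_mul x y) =
  \sum_(A : {set 'I_n}) cliff_sign R A (symd A C) *
    (cliff_coef A x * cliff_coef (symd A C) y).
Proof. by rewrite /cliff_coef ffunE. Qed.

Lemma cliff_mulA : associative (@cliff_mul R n).
Proof.
move=> x y z; apply: cliffP => D; rewrite !cliff_coef_mul.
under eq_bigr do rewrite cliff_coef_mul !mulr_sumr.
under [RHS]eq_bigr do rewrite cliff_coef_mul mulr_suml mulr_sumr.
rewrite [RHS]exchange_big /=; apply: eq_bigr => A _.
rewrite (reindex_inj (can_inj (symdK A))) /=; apply: eq_bigr => E _.
have -> : symd (symd A E) (symd A D) = symd E D.
  by rewrite (symdC A E) -symdA symdK.
have eqs : cliff_sign R A (symd A D) * cliff_sign R (symd A E) (symd E D) =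
           cliff_sign R E (symd E D) * cliff_sign R A (symd A E).
  have -> : symd A D = symd (symd A E) (symd E D) by rewrite -symdA symdK.
  rewrite (cliff_signDr A) (cliff_signDl A).
  have ss : cliff_sign R A (symd E D) * cliff_sign R A (symd E D) = 1.
    rewrite /cliff_sign -big_split big1 //= => i _.
    exact: cliff_sign_row_sq.
  by rewrite mulrA -(mulrA (cliff_sign R A _)) ss mulr1 mulrC.
transitivity (cliff_sign R A (symd A D) * cliff_sign R (symd A E) (symd E D) *
  (cliff_coef A x * (cliff_coef (symd A E) y * cliff_coef (symd E D) z))).
  by rewrite -!mulrA; congr (_ * _); rewrite mulrCA.
rewrite eqs -!mulrA; congr (_ * _); congr (_ * _).
Qed.

Lemma cliff_mul1l : left_id (cliff_mono R finset.set0) (@cliff_mul R n).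
Proof.
move=> x; apply: cliffP => C; rewrite cliff_coef_mul (bigD1 finset.set0) //=.
rewrite big1 => [|A /negbTE A0]; last by rewrite cliff_coef_mono A0 mul0r mulr0.
by rewrite symd0 cliff_sign0l cliff_coef_mono eqxx addr0 !mul1r.
Qed.

Lemma cliff_mul1r : right_id (cliff_mono R finset.set0) (@cliff_mul R n).
Proof.
move=> x; apply: cliffP => C; rewrite cliff_coef_mul (bigD1 C) //=.
have symdv : symd C C = finset.set0 by apply/setP => i; rewrite !inE addbb.
rewrite big1 => [|A AC].
  by rewrite symdv cliff_sign0r cliff_coef_mono eqxx addr0 mul1r mulr1.
rewrite cliff_coef_mono; case: eqP => [e|_]; last by rewrite !mulr0.
case/eqP: AC; rewrite -[RHS](symdK A) e.
by rewrite symdC symd0.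
Qed.

Lemma cliff_mulDl : left_distributive (@cliff_mul R n) +%R.
Proof.
move=> x y z; apply: cliffP => C.
rewrite cliff_coefD !cliff_coef_mul -big_split /=.
by apply: eq_bigr => A _; rewrite cliff_coefD mulrDl mulrDr.
Qed.

Lemma cliff_mulDr : right_distributive (@cliff_mul R n) +%R.
Proof.
move=> x y z; apply: cliffP => C.
rewrite cliff_coefD !cliff_coef_mul -big_split /=.
by apply: eq_bigr => A _; rewrite cliff_coefD mulrDr mulrDr.
Qed.

Lemma cliff1_neq0 : cliff_mono R (finset.set0 : {set 'I_n}) != 0.
Proof.
apply/eqP => /(congr1 (cliff_coef finset.set0)).
by rewrite cliff_coef_mono eqxx /cliff_coef ffunE => /eqP; rewrite oner_eq0.
Qed.

End CliffRing.

HB.instance Definition _ (R : realType) (n : nat) :=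
  GRing.Zmodule_isNzRing.Build (cliff R n) (@cliff_mulA R n) (@cliff_mul1l R n)
    (@cliff_mul1r R n) (@cliff_mulDl R n) (@cliff_mulDr R n)
    (@cliff1_neq0 R n).

Fact cliff_scalerAl (R : realType) (n : nat) (a : R) (x y : cliff R n) :
  a *: (x * y) = a *: x * y.
Proof.
apply: cliffP => C; rewrite cliff_coefZ !cliff_coef_mul mulr_sumr.
by apply: eq_bigr => A _; rewrite cliff_coefZ mulrCA !mulrA.
Qed.

Fact cliff_scalerAr (R : realType) (n : nat) (a : R) (x y : cliff R n) :
  a *: (x * y) = x * (a *: y).
Proof.
apply: cliffP => C; rewrite cliff_coefZ !cliff_coef_mul mulr_sumr.
apply: eq_bigr => A _; rewrite cliff_coefZ mulrCA; congr (_ * _).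
by rewrite mulrCA.
Qed.

HB.instance Definition _ (R : realType) (n : nat) :=
  GRing.Lmodule_isLalgebra.Build R (cliff R n) (@cliff_scalerAl R n).
HB.instance Definition _ (R : realType) (n : nat) :=
  GRing.Lalgebra_isAlgebra.Build R (cliff R n) (@cliff_scalerAr R n).
(* Provides the inverse x^-1 of the invertible elements of the algebra. *)
HB.instance Definition _ (R : realType) (n : nat) :=
  Algebra_isFalgebra.Build R (cliff R n).

Definition cliff_gen (R : realType) (n : nat) (i : 'I_n) : cliff R n :=
  cliff_mono R [set i]%SET.

Section CliffRelations.
Context {R : realType} {n : nat}.

Lemma cliff_monoM (A B : {set 'I_n}) :
  cliff_mono R A * cliff_mono R B = cliff_sign R A B *: cliff_mono R (symd A B).
Proof.
apply: cliffP => C; rewrite cliff_coef_mul cliff_coefZ (bigD1 A) //=.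
rewrite big1 => [|D /negbTE DA]; last by rewrite cliff_coef_mono DA mul0r mulr0.
rewrite !cliff_coef_mono eqxx mul1r addr0.
have -> : (symd A C == B) = (C == symd A B).
  by apply/eqP/eqP => [<-|->]; rewrite symdK.
by case: eqP => [->|_]; rewrite ?mulr0 // symdK.
Qed.

Lemma cliff_sign11 (i j : 'I_n) :
  cliff_sign R [set i]%SET [set j]%SET = if (j <= i)%N then -1 else 1.
Proof.
by rewrite /cliff_sign big_set1 big_mkcondr /= big_set1.
Qed.

Lemma cliff_gen_sqr (i : 'I_n) : cliff_gen R i * cliff_gen R i = -1.
Proof.
rewrite cliff_monoM cliff_sign11 leqnn scaleN1r; congr (- _).
by congr cliff_mono; apply/setP => j; rewrite !inE addbb.
Qed.

Lemma cliff_gen_anticomm (i j : 'I_n) : i != j ->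
  cliff_gen R i * cliff_gen R j = - (cliff_gen R j * cliff_gen R i).
Proof.
move=> ij; rewrite !cliff_monoM symdC !cliff_sign11 -scaleNr; congr (_ *: _).
by have := ij; rewrite -val_eqE /=; case: ltngtP; rewrite ?opprK.
Qed.

Lemma cliff_mono_prod (A : {set 'I_n}) :
  cliff_mono R A = \prod_(i <- enum A) cliff_gen R i.
Proof.
have : sorted (fun i j : 'I_n => (i < j)%N) (enum A).
  rewrite /enum_mem; apply: sorted_filter; first by move=> j i k; apply: ltn_trans.
  by rewrite -enumT -(@sorted_map _ _ (@nat_of_ord n) ltn) val_enum_ord iota_ltn_sorted.
have -> : A = [set i in enum A]%SET by apply/setP => i; rewrite inE mem_enum.
have -> : enum [set i in enum A]%SET = enum A.
  by apply: eq_enum => i; rewrite inE mem_enum.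
elim: (enum A) => [_|i s IHs].
  by rewrite big_nil; congr cliff_mono; apply/setP => i; rewrite !inE.
rewrite /= path_sortedE; last by move=> j k l; apply: ltn_trans.
case/andP=> /allP lt_is s_sorted; rewrite big_cons -IHs // cliff_monoM.
rewrite /cliff_sign big_set1 big_pred0 => [|j]; last first.
  by rewrite inE; apply/andP => -[/lt_is /= /ltn_geF ->].
rewrite scale1r; congr cliff_mono; apply/setP => j; rewrite !inE.
case: eqP => [->|//]; case: (boolP (i \in s)) => // /lt_is.
by rewrite /= ltnn.
Qed.

End CliffRelations.

(* Euclidean n-space with its standard orthonormal basis, inside cliff R n. *)
Definition cliff_vec (R : realType) (n : nat) (v : 'rV[R]_n) : cliff R n :=
  \sum_(i < n) v ord0 i *: cliff_gen R i.

Definition is_unit_vec (R : realType) (n : nat) (v : 'rV[R]_n) : Prop :=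
  \sum_(i < n) v ord0 i ^+ 2 = 1.

Definition Spin (R : realType) (n : nat) : set (cliff R n) :=
  [set x | exists vs : seq 'rV[R]_n,
     [/\ ~~ odd (size vs), forall v, v \in vs -> is_unit_vec v &
         x = \prod_(v <- vs) cliff_vec v]].
Arguments Spin R n : clear implicits.

Definition is_subgroup (R : realType) (n : nat) (G F : set (cliff R n)) : Prop :=
  [/\ F `<=` G, F 1, forall x y, F x -> F y -> F (x * y) &
      forall x, F x -> F x^-1].

Definition is_abelian (R : realType) (n : nat) (F : set (cliff R n)) : Prop :=
  forall x y, F x -> F y -> x * y = y * x.

Definition generated (R : realType) (n : nat) (G S : set (cliff R n)) :
    set (cliff R n) :=
  smallest (is_subgroup G) S.

Definition conjugate_in (R : realType) (n : nat) (G F F' : set (cliff R n)) :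
    Prop :=
  exists2 g, G g & [set g * x * g^-1 | x in F] = F'.

(* The Lie algebra of a closed subgroup G of the unit group of cliff R n, as the
   set of velocities at 1 of the curves drawn in G. *)
Definition lie_algebra (R : realType) (n : nat) (G : set (cliff R n)) :
    set (cliff R n) :=
  [set X | exists gamma : R -> cliff R n,
     [/\ gamma 0 = 1, forall t, G (gamma t) &
         forall A : {set 'I_n}, is_derive (0 : R) (1 : R)
           (fun t : R => cliff_coef A (gamma t)) (cliff_coef A X)]].

(* The fixed subalgebra of the adjoint action of F on the Lie algebra of G. *)
Definition lie_fixed (R : realType) (n : nat) (G F : set (cliff R n)) :
    set (cliff R n) :=
  [set X | lie_algebra G X /\ forall f, F f -> f * X * f^-1 = X].

(* dim g_0^F = dim F, the dimension of the closed subgroup F being that of its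
   Lie algebra (hence 0 when F is finite). *)
Definition condition_star (R : realType) (n : nat) (G F : set (cliff R n)) :
    Prop :=
  exists U W : {vspace cliff R n},
    [/\ [set` U] = lie_fixed G F, [set` W] = lie_algebra F & \dim U = \dim W].

(* e_s1 e_s2 ... e_sk for s = [:: s1; ...; sk], with indices starting from 1. *)
Definition cliff_e (R : realType) (n : nat) (s : seq nat) : cliff R n.+1 :=
  \prod_(k <- s) cliff_gen R (inord k.-1).

Definition F12 (R : realType) : set (cliff R 12) :=
  generated (Spin R 12) [set` [:: -1; cliff_e R 11 (iota 1 12);
    cliff_e R 11 [:: 1; 2; 3; 4]%N; cliff_e R 11 [:: 1; 2; 5; 6]%N;
    cliff_e R 11 [:: 1; 2; 7; 8]%N; cliff_e R 11 [:: 1; 2; 9; 10]%N;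
    cliff_e R 11 [:: 1; 3; 5; 7; 9; 11]%N]].
Arguments F12 R : clear implicits.

Definition F14 (R : realType) : set (cliff R 14) :=
  generated (Spin R 14) [set` [:: -1; cliff_e R 13 (iota 1 14);
    cliff_e R 13 [:: 1; 2; 3; 4]%N; cliff_e R 13 [:: 1; 2; 5; 6]%N;
    cliff_e R 13 [:: 1; 3; 5; 7]%N; cliff_e R 13 [:: 8; 9; 10; 11]%N;
    cliff_e R 13 [:: 8; 9; 12; 13]%N; cliff_e R 13 [:: 8; 10; 12; 14]%N]].
Arguments F14 R : clear implicits.

(* Main.v *)
Require Import Defs.
From HB Require Import structures.
From mathcomp Require Import all_boot all_order all_algebra all_field.
From mathcomp Require Import zify ring lra.
Set Implicit Arguments.
Unset Strict Implicit.
Unset Printing Implicit Defensive.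
Import Order.TTheory GRing.Theory Num.Theory.
Local Open Scope ring_scope.

(** Each f in F acts on R^n by v |-> f v f^-1, through an orthogonal matrix M_f.
    A skew-symmetric matrix S commuting with all the M_f gives a bivector
    \sum_(i, j) S_ij e_i e_j fixed by F. The Lie algebra of a finite group is 0,
    so that condition star leaves no such matrix but 0 ([antisym_fixed]).
    Applied to M_f - M_f^T, this makes the M_f symmetric, hence commuting
    involutions, which have a common eigenbasis; applied in that basis to
    E_ij - E_ji, it shows that distinct vectors of the basis have distinct
    systems of signs. The lines of the basis are thus orthogonal
    ([simultaneous_eigenframe]).

    Every orthonormal frame is, up to signs, the image of the standard one under
    an element of the spin group ([Spin_frame]). After conjugation by this
    element, F consists of signed monomials e_A and -e_A, where A runs over a
    binary code C, a set of subsets of {1, ..., n} stable under symmetric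
    difference ([conj_mono_group]). The code contains the whole set because c is
    in F, it is self-orthogonal because F is abelian, and its dual has no word
    of weight 2 because the signs separate the vectors of the frame. Up to
    signs, the spin group induces all permutations of the letters, so it remains
    to see that there is only one such code up to permutation when n = 12 or
    n = 14.

    The sum over a code K of the character A |-> (-1)^|S n A| is |K| or 0
    according to whether S lies in the dual of K ([sum_chi]). Hence the moments
    of n - 2|A| over K count the words of small weight in the dual of K. Let C0
    be the subcode [doubly_even C] of the words of weight divisible by 4,
    abbreviated to D in the proofs.

    In length 12, the second moments over C and over C0 give |C| = 64, so that C
    is self-dual, and show that each letter i has exactly one twin: a letter
    j != i that no word of C0 separates from i. A word of C outside C0 has
    weight 6 and contains exactly one letter of each of the six pairs of twins;
    listing the letters accordingly exhibits the generators of F12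
    ([labelling12]).

    In length 14, the value 14 - 2|A| is 6 or -2 on the nonzero words of C0; the
    moments of the polynomial vanishing at 6 and -2 give |C0| = 64, so that C is
    self-dual, and show that each letter lies in three lines: words of weight 3
    in the dual of C0. Among three lines an odd number of pairs meet in an odd
    number of letters ([chi_odd3]), from which it follows that collinearity is
    an equivalence relation ([nbr_trans]). It has two classes of seven letters,
    each of them a Fano plane, and the sums of two lines provide the generators
    of F14 ([heptad], [labelling14]).

    In both cases the code generated by the words of the model contains its dual,
    so these words generate any self-orthogonal code containing them
    ([dual_in_span_word]), and the two groups agree ([conjugate_generated]). *)

(** * Binary codes as sets of words *)

(** A set A stands for the vector of F_2^n with support A, addition being [symd];
    chi S is the character A |-> (-1)^|S n A| of F_2^n. *)
Definition chi n (S A : {set 'I_n}) : int :=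
  \prod_i (-1) ^+ ((i \in S) && (i \in A)).

Definition is_code n (D : {set {set 'I_n}}) : Prop :=
  set0 \in D /\ {in D &, forall A B, symd A B \in D}.

Definition dual_code n (D : {set {set 'I_n}}) : {set {set 'I_n}} :=
  [set S | [forall A in D, chi S A == 1]].

Section Characters.
Context {n : nat}.
Implicit Types (S T A B : {set 'I_n}) (D : {set {set 'I_n}}) (i j k : 'I_n).

Lemma chiC S A : chi S A = chi A S.
Proof. by apply: eq_bigr => i _; rewrite andbC. Qed.

Lemma chi_symdl S T A : chi (symd S T) A = chi S A * chi T A.
Proof.
rewrite /chi -big_split /=; apply: eq_bigr => i _; rewrite inE.
by case: (i \in S) (i \in T) (i \in A) => [] [] [].
Qed.

Lemma chi_symdr S A B : chi S (symd A B) = chi S A * chi S B.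
Proof. by rewrite !(chiC S) chi_symdl. Qed.

Lemma chi_card S A : chi S A = (-1) ^+ #|S :&: A|.
Proof.
rewrite /chi (bigID (mem (S :&: A))) /= [X in _ * X]big1 ?mulr1; last first.
  by move=> i; rewrite inE => /negbTE ->.
under eq_bigr => i iSA do rewrite -in_setI iSA expr1.
by rewrite prodr_const.
Qed.

Lemma chi0r S : chi S set0 = 1. Proof. by rewrite chi_card setI0 cards0. Qed.
Lemma chiTl A : chi setT A = (-1) ^+ #|A|. Proof. by rewrite chi_card setTI. Qed.
Lemma chi1l i A : chi [set i] A = (-1) ^+ (i \in A).
Proof.
rewrite chi_card; case: (boolP (i \in A)) => iA.
  by rewrite (setIidPl _) ?sub1set // cards1.
by rewrite disjoint_setI0 ?disjoints1 // cards0.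
Qed.

Lemma chi_pm S A : chi S A != 1 -> chi S A = -1.
Proof. by rewrite chi_card -signr_odd; case: odd; rewrite ?expr1 ?expr0 ?eqxx. Qed.

End Characters.

Section Codes.
Context {n : nat}.
Implicit Types (S T A B : {set 'I_n}) (D : {set {set 'I_n}}) (i j k : 'I_n).

Lemma dual_codeP D S :
  reflect {in D, forall A, chi S A = 1} (S \in dual_code D).
Proof. by rewrite inE; apply: (iffP 'forall_in_eqP). Qed.

Lemma is_code_dual D : is_code (dual_code D).
Proof.
split=> [|S T /dual_codeP S1 /dual_codeP T1]; apply/dual_codeP => A AD.
  by rewrite chiC chi0r.
by rewrite chi_symdl S1 ?T1.
Qed.

Lemma notin_dual D S : S \notin dual_code D -> exists2 A, A \in D & chi S A = -1.
Proof.
by rewrite inE negb_forall_in => /exists_inP [A AD /chi_pm]; exists A.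
Qed.

(** If chi S is -1 at B, adding B permutes D and changes the sign of each term. *)
Lemma sum_chi D S : is_code D ->
  \sum_(A in D) chi S A = if S \in dual_code D then #|D|%:Z else 0.
Proof.
case=> D0 DD; case: ifPn => [/dual_codeP S1 | /notin_dual [B BD SB]].
  by rewrite (eq_bigr (fun=> 1)) // sumr_const natz.
suff /eqP : \sum_(A in D) chi S A = - \sum_(A in D) chi S A by lia.
rewrite [LHS](reindex_inj (can_inj (symdK B))) -sumrN /=; apply: eq_big => A.
  by apply/idP/idP => [BA|]; [rewrite -(symdK B A)|]; apply: DD.
by move=> _; rewrite chi_symdr SB mulN1r.
Qed.

(** Both sides are the sum of chi S A over all S and all A in D: summing first
    over A selects the S in the dual, summing first over S selects A = set0. *)
Lemma card_dual D : is_code D -> (#|D| * #|dual_code D| = 2 ^ n)%N.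
Proof.
move=> cD; pose T := [set: {set 'I_n}].
have cT : is_code T by split=> [|A B _ _]; rewrite inE.
have dT : dual_code T = [set set0].
  apply/setP => S; rewrite in_set1; apply/dual_codeP/eqP => [S1|-> A _].
    apply/setP => i; rewrite inE; apply/negbTE/negP => iS.
    by have := S1 [set i] (in_setT _); rewrite chiC chi1l iS.
  by rewrite chiC chi0r.
have cardT : #|T| = (2 ^ n)%N.
  have -> : T = powerset setT by apply/setP => A; rewrite !inE subsetT.
  by rewrite card_powerset cardsT card_ord.
apply/eqP; rewrite -eqz_nat -cardT PoszM.
have /eqP -> : #|T|%:Z == \sum_(A in D) \sum_(S in T) chi A S :> int.
  under eq_bigr do rewrite (sum_chi _ cT) dT in_set1.
  case: (cD) => D0 _; rewrite -big_mkcondr /= (big_pred1 set0) // => A.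
  by apply/andP/eqP => [[_ /eqP ->]|] // ->; rewrite ?eqxx ?D0.
rewrite exchange_big /=.
under eq_bigr => S _ do under eq_bigr do rewrite chiC.
under eq_bigr do rewrite (sum_chi _ cD).
rewrite -big_mkcondr /= sumr_const -mulr_natr natz; apply/eqP; congr (_ * Posz _).
by apply: eq_card => S; rewrite [RHS]unfold_in /= in_setT.
Qed.

Lemma is_code_setT_dual D A : setT \in D -> A \in dual_code D -> ~~ odd #|A|.
Proof.
move=> DT /dual_codeP /(_ _ DT); rewrite chiC chiTl -signr_odd.
by case: odd.
Qed.

End Codes.

(** * Projective self-orthogonal codes and their moments *)

(** Two letters that no word separates form a word of weight 2 of the dual code:
    the last condition asks for a system of distinct letters. *)
Definition projective_code n (C : {set {set 'I_n}}) : Prop :=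
  [/\ is_code C, setT \in C, C \subset dual_code C &
      forall i j, i != j -> symd [set i] [set j] \notin dual_code C].

Definition doubly_even n (C : {set {set 'I_n}}) : {set {set 'I_n}} :=
  [set A in C | 4 %| #|A|]%N.

(** Positions are counted from 1. *)
Definition word n (L : seq 'I_n.+1) (g : seq nat) : {set 'I_n.+1} :=
  [set x in [seq nth ord0 L k.-1 | k <- g]].

(** The discrepancy between the coordinates outside and inside A: as a sum of
    characters, its moments over a code count small words of the dual. *)
Definition disc n (A : {set 'I_n}) : int := \sum_i chi [set i] A.

Section Moments.
Context {n : nat}.
Implicit Types (S T A B : {set 'I_n}) (C D : {set {set 'I_n}}) (i j k : 'I_n).

Lemma card_indicator A : #|A| = (\sum_i (i \in A))%N.
Proof. by rewrite -sum1_card big_mkcond; apply: eq_bigr => i _; case: (_ \in _). Qed.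

Lemma discE A : disc A = n%:Z - (#|A|.*2)%:Z.
Proof.
have -> : #|A|.*2%:Z = \sum_i (2 * (i \in A))%:Z.
  rewrite card_indicator -mul2n big_distrr /= -natz natr_sum.
  by apply: eq_bigr => i _; rewrite natz.
rewrite -[n in n%:Z]card_ord -natz -sumr_const -sumrB /disc.
by apply: eq_bigr => i _; rewrite chi1l; case: (i \in A).
Qed.

Lemma sum_chi_disc D S : is_code D ->
  \sum_(A in D) chi S A * disc A =
  #|D|%:Z * #|[set i | symd S [set i] \in dual_code D]|%:Z.
Proof.
move=> cD; under eq_bigr do rewrite /disc mulr_sumr.
rewrite exchange_big /=.
under eq_bigr => i _ do under eq_bigr do rewrite -chi_symdl.
under eq_bigr do rewrite (sum_chi _ cD).
rewrite -big_mkcond /= sumr_const -mulr_natr natz; congr (_ * Posz _).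
by apply: eq_card => i; rewrite inE.
Qed.

Lemma sum_chi_disc2 D S : is_code D ->
  \sum_(A in D) chi S A * disc A ^+ 2 =
  #|D|%:Z * \sum_i #|[set j | symd (symd S [set i]) [set j] \in dual_code D]|%:Z.
Proof.
move=> cD; rewrite mulr_sumr.
under [RHS]eq_bigr do rewrite -sum_chi_disc //.
rewrite exchange_big /=; apply: eq_bigr => A _.
rewrite -mulr_suml expr2 mulrA; congr (_ * _).
by rewrite mulr_sumr; apply: eq_bigr => i _; rewrite chi_symdl.
Qed.

Lemma sum_indicator (T' : finType) (E : {set T'}) a : a \in E ->
  \sum_(x in E) (x == a)%:Z = 1.
Proof.
by move=> Ea; rewrite (bigD1 a) //= eqxx big1 ?addr0 // => x /andP [_ /negbTE ->].
Qed.

Lemma symd_trans S A B : symd (symd S A) (symd S B) = symd A B.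
Proof. by rewrite (symdC S) -symdA symdK. Qed.

Lemma symdv A : symd A A = set0.
Proof. by apply/setP => i; rewrite !inE addbb. Qed.

Lemma card_symd A B : (#|symd A B| + #|A :&: B|.*2 = #|A| + #|B|)%N.
Proof.
rewrite !card_indicator -muln2 big_distrl /= -!big_split /=.
by apply: eq_bigr => i _; rewrite !inE; case: (i \in A) (i \in B) => [] [].
Qed.

Lemma selforth_even C A B : C \subset dual_code C -> A \in C -> B \in C ->
  ~~ odd #|A :&: B|.
Proof.
move=> /subsetP sC AC BC; have /dual_codeP /(_ _ BC) := sC _ AC.
by rewrite chi_card -signr_odd; case: odd.
Qed.

Lemma card_index2 C D B : D \subset C -> B \in C ->
  {in C & D, forall A A', symd A A' \in C} ->
  {in C, forall A, (symd B A \in D) = (A \notin D)} -> #|C| = (#|D|.*2)%N.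
Proof.
move=> sDC BC CD BD; rewrite -(cardsID D C) (setIidPr sDC) -addnn.
congr addn; rewrite -(card_imset (mem D) (can_inj (symdK B))); apply: eq_card => A.
rewrite inE; apply/andP/imsetP => [[AD AC]|[A' A'D ->]].
  by exists (symd B A); rewrite ?symdK // BD.
have BA'C : symd B A' \in C by exact: CD.
by rewrite BA'C -BD // symdK.
Qed.

Lemma chi_word (l : seq 'I_n) A : uniq l ->
  chi [set x in l] A = \prod_(x <- l) chi [set x] A.
Proof.
elim: l => [_|x l IHl /= /andP [xl ul]].
  by rewrite big_nil chiC -(chi0r A); congr chi; apply/setP => i; rewrite !inE.
rewrite big_cons -IHl // -chi_symdl; congr chi; apply/setP => i; rewrite !inE.
by case: eqVneq => [->|//]; rewrite (negbTE xl).
Qed.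

Section Projective.
Context {C : {set {set 'I_n}}}.
Context (pC : projective_code C).

Let cC : is_code C. Proof. by case: pC. Qed.
Let TC : setT \in C. Proof. by case: pC. Qed.
Let sC : C \subset dual_code C. Proof. by case: pC. Qed.

Lemma projective_even A : A \in C -> ~~ odd #|A|.
Proof. by move=> /(subsetP sC); apply: is_code_setT_dual. Qed.

Lemma projective_card2 A : A \in dual_code C -> #|A| != 2.
Proof.
move=> AC; apply/eqP => A2; have /cards2P [i [j [ij eA]]] : #|A| == 2 by apply/eqP.
case: pC => _ _ _ /(_ i j ij) /negP; apply.
suff <- : A = symd [set i] [set j] by [].
rewrite eA; apply/setP => k; rewrite !inE.
by case: (eqVneq k i) => [->|]; rewrite ?(negbTE ij).
Qed.

Lemma projective_sub A : A \in C -> A \in dual_code C.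
Proof. exact: (subsetP sC). Qed.

Lemma sum_disc2 : \sum_(A in C) disc A ^+ 2 = n%:Z * #|C|%:Z.
Proof.
have d1 i : #|[set j | symd (symd set0 [set i]) [set j] \in dual_code C]| = 1%N.
  have -> : [set j | symd (symd set0 [set i]) [set j] \in dual_code C] = [set i].
    apply/setP => j; rewrite in_set in_set1 symd0.
    apply/idP/eqP => [|->]; last by rewrite symdv; case: (is_code_dual C).
    by apply: contraTeq => ji; case: pC => _ _ _; apply; rewrite eq_sym.
  by rewrite cards1.
have := sum_chi_disc2 set0 cC; under eq_bigr do rewrite chiC chi0r mul1r.
by move=> ->; under eq_bigr do rewrite d1; rewrite sumr_const card_ord natz mulrC.
Qed.

Lemma symd_setT A : symd setT A = ~: A.
Proof. by apply/setP => i; rewrite !inE. Qed.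

Lemma projective_setC A : A \in C -> ~: A \in C.
Proof. by move=> AC; rewrite -symd_setT; case: cC => _; apply. Qed.

Lemma doubly_even_sub : doubly_even C \subset C.
Proof. by apply/subsetP => A; rewrite inE => /andP []. Qed.

(** Two words meet in an even number of letters, so modulo 4 the weight of their
    sum is the sum of their weights. *)
Lemma symd_doubly_even A B : A \in C -> B \in C ->
  (symd A B \in doubly_even C) = ((A \in doubly_even C) == (B \in doubly_even C)).
Proof.
move=> AC BC; have AB : symd A B \in C by case: cC => _; apply.
rewrite !inE AC BC AB /=.
have := card_symd A B; have := selforth_even sC AC BC.
have := projective_even AC; have := projective_even BC.
case: (boolP (4 %| #|symd A B|)%N); case: (boolP (4 %| #|A|)%N);
  by case: (boolP (4 %| #|B|)%N) => //=; lia.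
Qed.

Lemma is_code_doubly_even : is_code (doubly_even C).
Proof.
split=> [|A B AD BD]; first by rewrite inE cards0 dvdn0 andbT; case: cC.
have sub := subsetP doubly_even_sub.
by rewrite symd_doubly_even ?sub // AD BD.
Qed.

Lemma card_doubly_even B : B \in C -> B \notin doubly_even C ->
  #|C| = (#|doubly_even C|.*2)%N.
Proof.
move=> BC BD; apply: (card_index2 doubly_even_sub BC) => [A A' AC A'D|A AC].
  by case: cC => _; apply=> //; apply: (subsetP doubly_even_sub).
by rewrite symd_doubly_even // (negbTE BD) eq_sym eqbF_neg.
Qed.

(** C0 has index at most 2 in C, so one word B outside C0 is enough to test
    whether a word orthogonal to C0 is orthogonal to C. *)
Lemma dual_doubly_even B S : B \in C -> B \notin doubly_even C -> chi S B = 1 ->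
  S \in dual_code (doubly_even C) -> S \in dual_code C.
Proof.
move=> BC BD SB /dual_codeP SD; apply/dual_codeP => A AC.
have [AD|AD] := boolP (A \in doubly_even C); first exact: SD.
have BA : symd B A \in doubly_even C.
  by rewrite symd_doubly_even // (negbTE BD) (negbTE AD).
by have := SD _ BA; rewrite chi_symdr SB mul1r.
Qed.

Lemma selfdual_card : (#|C| * #|C| = 2 ^ n)%N -> dual_code C = C.
Proof.
move=> CC; apply/eqP; rewrite eq_sym eqEcard sC /=.
have := card_dual cC; have : (0 < #|C|)%N by apply/card_gt0P; exists setT.
by move=> C0 /eqP; rewrite -CC eqn_pmul2l // => /eqP ->.
Qed.

End Projective.
End Moments.

(** * The code of length 12 *)

(** Words are given by the positions of their letters, counted from 1. *)
Definition gens12 : seq (seq nat) :=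
  [:: iota 1 12; [:: 1; 2; 3; 4]; [:: 1; 2; 5; 6]; [:: 1; 2; 7; 8];
      [:: 1; 2; 9; 10]; [:: 1; 3; 5; 7; 9; 11]]%N.

Section Length12.
Context {C : {set {set 'I_12}}} (pC : projective_code C).
Implicit Types (S A : {set 'I_12}) (i j k : 'I_12).
Let D := doubly_even C.

Lemma card_word12 A : A \in C -> A \notin D -> #|A| = 6%N.
Proof.
move=> CA; have := projective_even pC CA; rewrite /D inE CA /=.
have := projective_card2 pC (projective_sub pC CA).
have := projective_card2 pC (projective_sub pC (projective_setC pC CA)).
have := cardsC A; rewrite card_ord; move: #|A| #|~: A| => a b; lia.
Qed.

(** The weights are 0, 4, 8 and 12, so the squares are 144 on the two extreme
    words and 16 on the others. *)
Lemma disc2_doubly_even12 A : A \in D ->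
  disc A ^+ 2 = 16 + 128 * (A == set0)%:Z + 128 * (A == setT)%:Z.
Proof.
rewrite /D inE discE -cards_eq0 => /andP [CA d4].
have le12 : (#|A| <= 12)%N by have := max_card (mem A); rewrite card_ord.
have -> : (A == setT) = (#|A| == 12).
  by rewrite eqEcard subsetT cardsT card_ord eqn_leq le12.
move: #|A| d4 le12 => m d4 m12 {CA}.
by do 13 (case: m d4 m12 => [|m] d4 m12; first by []).
Qed.

(** The words outside C0 have weight 6, hence discrepancy 0. *)
Lemma disc2_split12 : \sum_(A in C) disc A ^+ 2 = \sum_(A in D) disc A ^+ 2.
Proof.
have sDC : D \subset C by apply: doubly_even_sub.
rewrite (big_setID D) /= (setIidPr sDC) [X in _ + X]big1 ?addr0 // => A.
by rewrite inE => /andP [AD CA]; rewrite discE card_word12.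
Qed.

Lemma sum_disc2_even12 : \sum_(A in D) disc A ^+ 2 = 16 * #|D|%:Z + 256.
Proof.
have [D0 _] := is_code_doubly_even pC.
have DT : setT \in D by case: pC => _ TC _ _; rewrite inE TC cardsT card_ord.
rewrite (eq_bigr _ disc2_doubly_even12) big_split /= big_split /= -!mulr_sumr.
have -> : \sum_(A in D) (16 : int) = 16 * #|D|%:Z.
  by rewrite sumr_const -[_ *+ #|D|]mulr_natr (natz #|D|).
by rewrite !sum_indicator // -addrA.
Qed.

(** The two values of the second moment read 12 |C| = 16 |C0| + 256. This rules out
    C = C0, and then |C| = 2 |C0| determines both. *)
Lemma card_code12 : #|C| = 64%N /\ exists2 B, B \in C & B \notin D.
Proof.
have := disc2_split12; rewrite (sum_disc2 pC) sum_disc2_even12.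
have [/subsetP sCD|] := boolP (C \subset D).
  have -> : C = D by apply/eqP; rewrite eqEsubset doubly_even_sub andbT; apply/subsetP.
  by lia.
case/subsetPn => B CB DB; rewrite (card_doubly_even pC CB DB) -/D => e.
by split; [have {}e : 12 * (#|D|.*2)%:Z = 16 * #|D|%:Z + 256 := e; lia | exists B].
Qed.

Lemma selfdual12 : dual_code C = C.
Proof. by case: card_code12 => c64 _; apply: selfdual_card => //; rewrite c64. Qed.

Section Pairs.
Context (B : {set 'I_12}) (CB : B \in C) (DB : B \notin D).

Let twins i := [set j | symd [set i] [set j] \in dual_code D].

(** Otherwise the pair {i, j} would be orthogonal to B as well, and so to C. *)
Lemma chi_twins i j : j \in twins i -> j != i -> chi (symd [set i] [set j]) B = -1.
Proof.
rewrite inE => ij ji; apply: chi_pm; apply/eqP => h.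
have ij' : i != j by rewrite eq_sym.
case: (pC) => _ _ _ /(_ i j ij') /negP.
apply; exact: (dual_doubly_even pC CB DB h ij).
Qed.

(** Letters that C0 does not separate from i are separated from i by B. Two of
    them are therefore separated from each other neither by B nor by C0. *)
Lemma card_twins_le i : (#|twins i| <= 2)%N.
Proof.
have cD := is_code_dual D.
have ii : i \in twins i by rewrite inE symdv; case: cD.
rewrite (cardsD1 i) ii ltnS; apply/card_le1_eqP => k j.
rewrite !in_setD1 => /andP [ki kt] /andP [ji jt]; apply/eqP/negPn/negP => jk.
have jkD : symd [set j] [set k] \in dual_code D.
  rewrite in_set in jt; rewrite in_set in kt; rewrite -(symd_trans [set i] [set j]).
  by case: cD => _; apply.
case: (pC) => _ _ _ /(_ j k jk) /negP.
apply; apply: (dual_doubly_even pC CB DB _ jkD).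
by rewrite -(symd_trans [set i] [set j]) chi_symdl !chi_twins.
Qed.

(** The second moment over C0 is |C0| times the number of ordered pairs of letters
    that C0 does not separate. As it equals 24 |C0|, each of the 12 sets
    twins i has the maximal size 2. *)
Lemma card_twins i : #|twins i| = 2%N.
Proof.
have sum24 : (\sum_i #|twins i| = 24)%N.
  have : \sum_(A in D) disc A ^+ 2 = #|D|%:Z * (\sum_i #|twins i|)%N%:Z.
    transitivity (\sum_(A in D) chi set0 A * disc A ^+ 2).
      by apply: eq_bigr => A _; rewrite chiC chi0r mul1r.
    rewrite (sum_chi_disc2 _ (is_code_doubly_even pC)) -[X in _ = _ * X]natz natr_sum.
    congr (_ * _); apply: eq_bigr => i' _; rewrite natz; congr Posz.
    by apply: eq_card => j; rewrite !in_set symd0.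
  have := card_doubly_even pC CB DB; rewrite sum_disc2_even12.
  by case: card_code12 => -> _; rewrite -/D; move: #|D| => d; nia.
apply/eqP; rewrite eqn_leq card_twins_le leqNgt; apply/negP => lt.
have : (\sum_i #|twins i| < \sum_(i < 12) 2)%N.
  rewrite (bigD1 i) //= [X in (_ < X)%N](bigD1 i) //= -addSn.
  by apply: leq_add => //; apply: leq_sum => j _; apply: card_twins_le.
by rewrite sum24 sum_nat_const card_ord.
Qed.

Lemma twin_exists i :
  exists j, j != i /\ symd [set i] [set j] \in dual_code D.
Proof.
have cD := is_code_dual D.
have ii : i \in twins i by rewrite inE symdv; case: cD.
have := card_twins i; rewrite (cardsD1 i) ii add1n => -[] /eqP /cards1P [j ej].
have : j \in twins i :\ i by rewrite ej set11.
by rewrite in_setD1 => /andP [ji jt]; exists j; rewrite in_set in jt.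
Qed.

Lemma labelling12 : exists L : seq 'I_12,
  [/\ uniq L, size L = 12%N & {in gens12, forall g, word L g \in C}].
Proof.
have [p pP] := fin_all_exists twin_exists.
have cdD := is_code_dual D.
have pB i : (p i \in B) = (i \notin B).
  have [pi ti] := pP i; have := @chi_twins i (p i); rewrite in_set => /(_ ti pi).
  by rewrite chi_symdl !chi1l; case: (i \in B) (p i \in B) => [] [].
have p_inj : {in B &, injective p}.
  move=> i j iB jB eij; apply/eqP/negPn/negP => ij.
  case: (pC) => _ _ _ /(_ i j ij) /negP; apply.
  apply: (dual_doubly_even pC CB DB); first by rewrite chi_symdl !chi1l iB jB.
  rewrite -(symd_trans [set p i]) {2}eij (symdC [set p i]) (symdC [set p j]).
  by case: cdD => _; apply; [case: (pP i) | case: (pP j)].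
(* The union of two pairs of twins is orthogonal to C0 and, meeting B twice,
   to B: it belongs to the dual of C, which is C. *)
have pairC i j : uniq [:: i; p i; j; p j] -> [set x in [:: i; p i; j; p j]] \in C.
  move=> u; rewrite -selfdual12; apply/dual_codeP => A CA.
  rewrite chi_word // !big_cons big_nil mulr1 -(chi_symdl [set j]) mulrA.
  rewrite -(chi_symdl [set i]).
  have same k : chi (symd [set k] [set p k]) A = if A \in D then 1 else -1.
    have [pk /dual_codeP tk] := pP k; case: ifPn => [|AD]; first exact: tk.
    have BA : symd B A \in D by rewrite symd_doubly_even // (negbTE DB) (negbTE AD).
    have := tk _ BA; rewrite chi_symdr (@chi_twins k (p k)) //; last first.
      by rewrite in_set; case: (pP k).
    lia.
  by rewrite !same; case: ifP.
have : size (enum B) = 6%N by rewrite -cardE card_word12.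
have : [set x in enum B] = B by apply/setP => i; rewrite inE mem_enum.
have : uniq (enum B ++ map p (enum B)).
  rewrite cat_uniq enum_uniq map_inj_in_uniq ?enum_uniq ?andbT /=.
    by apply/hasPn => x /mapP [i]; rewrite !mem_enum => iB ->; rewrite pB iB.
  by move=> i j; rewrite !mem_enum; apply: p_inj.
case: (enum B) => [|q1 [|q3 [|q5 [|q7 [|q9 [|q11 [|? ?]]]]]]] //= uB eB _.
(* The letters of B take the odd positions, each followed by its twin. *)
pose L := [:: q1; p q1; q3; p q3; q5; p q5; q7; p q7; q9; p q9; q11; p q11].
have uL : uniq L.
  suff -> : uniq L = uniq ([:: q1; q3; q5; q7; q9; q11] ++
    [:: p q1; p q3; p q5; p q7; p q9; p q11]) by [].
  by apply: perm_uniq; apply/permP => P /=; ring.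
have um k : uniq (mask (true :: true :: ncons k false [:: true; true]) L).
  exact: mask_uniq.
have LT : [set x in L] = setT.
  by apply/eqP; rewrite eqEcard subsetT cardsT card_ord cardsE (card_uniqP uL).
exists L; split=> // g; rewrite !in_cons in_nil orbF.
case/or4P => [|||/or3P []] /eqP -> /=.
- by rewrite /word /= LT; case: pC.
- rewrite /word /=; exact: (pairC _ _ (um 0)).
- rewrite /word /=; exact: (pairC _ _ (um 2)).
- rewrite /word /=; exact: (pairC _ _ (um 4)).
- rewrite /word /=; exact: (pairC _ _ (um 6)).
- by rewrite /word /= eB.
Qed.

End Pairs.
End Length12.

(** * The code of length 14 *)

Definition gens14 : seq (seq nat) :=
  [:: iota 1 14; [:: 1; 2; 3; 4]; [:: 1; 2; 5; 6]; [:: 1; 3; 5; 7];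
      [:: 8; 9; 10; 11]; [:: 8; 9; 12; 13]; [:: 8; 10; 12; 14]]%N.

Section Length14.
Context {C : {set {set 'I_14}}} (pC : projective_code C).
Implicit Types (S A : {set 'I_14}) (i j k : 'I_14).
Let D := doubly_even C.
Let cD : is_code D. Proof. exact: is_code_doubly_even. Qed.
Let cdD : is_code (dual_code D). Proof. exact: is_code_dual. Qed.

Let TC : setT \in C. Proof. by case: pC. Qed.
Let TD : setT \notin D. Proof. by rewrite /D inE TC cardsT card_ord. Qed.

(** The discrepancies are 14, 6 and -2, and x^2 - 4x - 12 vanishes at 6 and -2. *)
Lemma disc_doubly_even14 A : A \in D ->
  disc A ^+ 2 = 4 * disc A + 12 + 128 * (A == set0)%:Z.
Proof.
rewrite /D inE discE -cards_eq0 => /andP [CA d4].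
have := projective_card2 pC (projective_sub pC (projective_setC pC CA)).
have := cardsC A; rewrite card_ord; move: #|A| #|~: A| d4 => m m' d4 e m'2.
have le14 : (m <= 14)%N by lia.
have {m' e m'2} m12 : m != 12 by lia.
by do 15 (case: m d4 le14 m12 => [|m] d4 le14 m12; first by []).
Qed.

(** The word setT has weight 14, so it generates C together with C0. *)
Lemma dual_even14 S : S \in dual_code D -> ~~ odd #|S| -> S \in dual_code C.
Proof.
move=> SD oS; apply: (dual_doubly_even pC TC TD _ SD).
by rewrite chi_card setIT -signr_odd (negbTE oS).
Qed.

Lemma sep14 i j : (symd [set i] [set j] \in dual_code D) = (i == j).
Proof.
apply/idP/eqP => [ijD|->]; last by rewrite symdv; case: cdD.
apply/eqP/negPn/negP => ij; case: (pC) => _ _ _ /(_ i j ij) /negP.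
apply; apply: (dual_even14 ijD).
by have := card_symd [set i] [set j]; rewrite !cards1; lia.
Qed.

Lemma sum_sep14 i : #|[set j | symd [set i] [set j] \in dual_code D]| = 1%N.
Proof.
apply: etrans (cards1 i); apply: eq_card => j.
by rewrite in_set sep14 in_set1 eq_sym.
Qed.

(** Multiplying the previous identity by a character and summing over C0 leaves
    only the contribution of set0. *)
Lemma moment14 S :
  #|D|%:Z * (\sum_i
    #|[set j | symd (symd S [set i]) [set j] \in dual_code D]|)%N%:Z =
  #|D|%:Z * (4 * #|[set i | symd S [set i] \in dual_code D]|%:Z +
             12 * (S \in dual_code D)%:Z) + 128.
Proof.
have -> : #|D|%:Z * (\sum_i
    #|[set j | symd (symd S [set i]) [set j] \in dual_code D]|)%N%:Z =
    \sum_(A in D) chi S A * disc A ^+ 2.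
  rewrite (sum_chi_disc2 _ cD) -[X in _ * X = _]natz natr_sum.
  by congr (_ * _); apply: eq_bigr => i' _; rewrite natz.
rewrite mulrDr mulrCA -(sum_chi_disc _ cD) mulrCA.
have -> : #|D|%:Z * (S \in dual_code D)%:Z = \sum_(A in D) chi S A.
  by rewrite (sum_chi _ cD); case: ifP => _; rewrite ?mulr1 ?mulr0.
have D0 : set0 \in D by case: cD.
rewrite -[128 in RHS]mulr1 -[X in 128 * X](sum_indicator D0).
rewrite !mulr_sumr -!big_split /=; apply: eq_bigr => A AD.
rewrite disc_doubly_even14 //.
case: eqVneq => [->|_]; rewrite ?mulr0 ?mulr1 ?chi0r; last by ring.
by ring.
Qed.

(** With Z the number of letters contained in no word of C0, the moment for
    S = set0 reads |C0| (2 - 4 Z) = 128. *)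
Lemma card_doubly_even14 : #|D| = 64%N /\ forall i, [set i] \notin dual_code D.
Proof.
have := moment14 set0; have -> : set0 \in dual_code D by case: cdD.
set Z := [set i | symd set0 [set i] \in dual_code D].
under eq_bigr do (under eq_finset do rewrite symd0).
under eq_bigr do rewrite sum_sep14.
rewrite sum_nat_const card_ord => e.
have [Z0 d64] : #|Z| = 0%N /\ #|D| = 64%N.
  by move: e; move: #|Z| #|D| => z d; case: z => [|z]; nia.
split=> // i; apply/negP => iD; suff : i \in Z by rewrite (card0_eq Z0).
by rewrite in_set symd0.
Qed.

Lemma selfdual14 : dual_code C = C.
Proof.
apply: (selfdual_card pC).
by rewrite (card_doubly_even pC TC TD); case: card_doubly_even14 => ->.
Qed.

(** The word {i, j, k}; it is called a line when it is orthogonal to C0, that is,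
    when the columns i, j and k of C0 sum to zero. *)
Definition line i j k := symd (symd [set i] [set j]) [set k].
Definition nbr i := [set j | [exists k, line i j k \in dual_code D]].

Lemma lineC i j k : line i j k = line j i k.
Proof. by rewrite /line (symdC [set i]). Qed.

Lemma lineAC i j k : line i j k = line i k j.
Proof. by rewrite /line -!symdA (symdC [set j]). Qed.

Lemma line_uniq i j k k' : line i j k \in dual_code D ->
  line i j k' \in dual_code D -> k = k'.
Proof.
move=> kD k'D; apply/eqP; rewrite -sep14 -(symd_trans (symd [set i] [set j])).
by case: cdD => _; apply.
Qed.

Lemma line_neq i j k : line i j k \in dual_code D -> i != j.
Proof.
apply: contraTneq => ->; rewrite /line symdv symd0.
by case: card_doubly_even14.
Qed.

Lemma card_line i j k : line i j k \in dual_code D -> odd #|line i j k|.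
Proof.
have := card_symd (symd [set i] [set j]) [set k].
by have := card_symd [set i] [set j]; rewrite /line !cards1; lia.
Qed.

(** The moment twisted by the character of i counts the ordered pairs (j, k) such
    that {i, j, k} is a line, and j determines k. *)
Lemma card_nbr i : #|nbr i| = 6%N.
Proof.
have [d64 nz] := card_doubly_even14.
have := moment14 [set i]; rewrite (negbTE (nz i)) sum_sep14 d64.
suff -> : (\sum_j #|[set k | line i j k \in dual_code D]| = #|nbr i|)%N by lia.
rewrite card_indicator; apply: eq_bigr => j _; rewrite in_set.
case: existsP => [[k ijk]|no]; last first.
  by apply: eq_card0 => k; rewrite in_set; apply/negP => ijk; case: no; exists k.
apply: etrans (cards1 k); apply: eq_card => k'; rewrite in_set in_set1.
by apply/idP/eqP => [/line_uniq /(_ ijk)|->].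
Qed.

Lemma line_perm i j k : line i j k \in dual_code D ->
  [/\ line i k j \in dual_code D, line j i k \in dual_code D &
      line j k i \in dual_code D].
Proof.
by move=> ijk; split; [rewrite lineAC | rewrite lineC | rewrite lineAC lineC].
Qed.

Lemma nbrP i j : reflect (exists k, line i j k \in dual_code D) (j \in nbr i).
Proof. by rewrite in_set; apply: existsP. Qed.

Lemma chi_line i j k A :
  chi (line i j k) A = (-1) ^+ ((i \in A) (+) (j \in A) (+) (k \in A)).
Proof.
by rewrite !chi_symdl !chi1l; case: (i \in A) (j \in A) (k \in A) => [] [] [].
Qed.

Lemma in_line x i j k : (x \in line i j k) = (x == i) (+) (x == j) (+) (x == k).
Proof. by rewrite !inE. Qed.

(** S + T and S + U have even weight, so they lie in the self-dual code C, hence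
    are orthogonal to each other, whereas S is not orthogonal to itself. *)
Lemma chi_odd3 S T U : S \in dual_code D -> T \in dual_code D ->
  U \in dual_code D -> odd #|S| -> odd #|T| -> odd #|U| ->
  chi S T * chi S U * chi T U = -1.
Proof.
move=> SD TD' UD oS oT oU.
have inC V : V \in dual_code D -> odd #|V| -> symd S V \in C.
  move=> VD oV; rewrite -selfdual14; apply: dual_even14; first by case: cdD => _; apply.
  by have := card_symd S V; lia.
have /dual_codeP /(_ _ (inC U UD oU)) := projective_sub pC (inC T TD' oT).
rewrite chi_symdl !chi_symdr (chiC T S) chi_card setIid -signr_odd oS expr1.
by rewrite -[chi S T * _ * _]mulrA; lia.
Qed.

(** Two lines through i coincide or meet in i only. *)
Lemma chi_line_meet i j k x y : line i j k \in dual_code D ->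
  line i x y \in dual_code D -> chi (line i j k) (line i x y) = -1.
Proof.
move=> ijk ixy; have [xj|xj] := eqVneq x j.
  rewrite {}xj in ixy *; rewrite -(line_uniq ijk ixy) chi_card setIid -signr_odd.
  by rewrite card_line.
have [ikj jik jki] := line_perm ijk; have [iyx xiy xyi] := line_perm ixy.
have [xk|xk] := eqVneq x k.
  rewrite {}xk in ixy *; rewrite -(line_uniq ikj ixy) (lineAC i k j).
  by rewrite chi_card setIid -signr_odd card_line.
have yj : y != j.
  by apply: contraNneq xk => e; rewrite e in iyx; rewrite (line_uniq iyx ijk).
have yk : y != k.
  by apply: contraNneq xj => e; rewrite e in iyx; rewrite (line_uniq iyx ikj).
rewrite chi_line !in_line eqxx (negbTE (line_neq ixy)) (negbTE (line_neq iyx)).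
rewrite ![j == _]eq_sym ![k == _]eq_sym (negbTE xj) (negbTE xk) (negbTE yj) (negbTE yk).
by rewrite (negbTE (line_neq ijk)) (negbTE (line_neq ikj)).
Qed.

Lemma nbr_sym i j : (j \in nbr i) = (i \in nbr j).
Proof. by apply/nbrP/nbrP => -[k /line_perm []]; exists k. Qed.

(** Let {i, j, k} and {j, l, m} be lines. Every line through i meets the first one
    in i, so by [chi_odd3] it meets the second one in an odd number of letters.
    If l were not collinear with i, every line through i would pass through j or
    m, and there would be at most two of them, not three. *)
Lemma nbr_trans i j l : j \in nbr i -> l \in nbr j -> l != i -> l \in nbr i.
Proof.
move=> /nbrP [k ijk] /nbrP [m jlm] li; apply/negPn/negP => lni.
have [ikj jik jki] := line_perm ijk; have [jml ljm lmj] := line_perm jlm.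
have mi : m != i.
  apply: contraNneq lni => e; rewrite e in jml.
  by have [_ ? _] := line_perm jml; apply/nbrP; exists j; rewrite lineAC.
pose t x := odflt i [pick y | line i x y \in dual_code D].
have tP x y : line i x y \in dual_code D -> y = t x.
  by move=> ixy; rewrite /t; case: pickP => [y' /(line_uniq ixy) //|/(_ y)]; rewrite ixy.
have sub : nbr i \subset [:: j; t j; m; t m].
  apply/subsetP => x /nbrP [y ixy]; have [iyx _ _] := line_perm ixy.
  have := chi_odd3 ijk ixy jlm (card_line ijk) (card_line ixy) (card_line jlm).
  rewrite (chi_line_meet ijk ixy) (lineC i j k) (chi_line_meet jik jlm) mulN1r opprK.
  rewrite mul1r chi_line !in_line ![i == _]eq_sym (negbTE li) (negbTE mi).
  rewrite (negbTE (line_neq jik)) !inE.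
  have nl z z' : line i z z' \in dual_code D -> (z == l) = false.
    by move=> h; apply: contraNF lni => /eqP <-; apply/nbrP; exists z'.
  rewrite (nl _ _ ixy) (nl _ _ iyx).
  have [//|xj] := eqVneq x j; have [//|xm] := eqVneq x m.
    by rewrite !orbT.
  have [yj _|yj] := eqVneq y j.
    by rewrite (tP _ _ (_ : line i j x \in _)) -?yj ?eqxx ?orbT.
  have [ym _|ym //] := eqVneq y m.
  by rewrite (tP _ _ (_ : line i m x \in _)) -?ym ?eqxx ?orbT.
have := leq_trans (subset_leq_card sub) (card_size _).
by rewrite card_nbr.
Qed.

Lemma word_dual14 (l : seq 'I_14) : uniq l -> ~~ odd (size l) ->
  {in D, forall A, \prod_(x <- l) chi [set x] A = 1} -> [set x in l] \in C.
Proof.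
move=> ul ol l1; rewrite -selfdual14; apply: dual_even14.
  by apply/dual_codeP => A AD; rewrite chi_word // l1.
by rewrite cardsE (card_uniqP ul).
Qed.

Lemma line_mem i j k A : line i j k \in dual_code D -> A \in D ->
  (k \in A) = (i \in A) (+) (j \in A).
Proof.
move=> /dual_codeP h /h; rewrite chi_line.
by case: (i \in A) (j \in A) (k \in A) => [] [] [].
Qed.

Lemma notin_line i j k : ~ (line i j k \in dual_code D) ->
  exists2 A, A \in D & (i \in A) (+) (j \in A) (+) (k \in A).
Proof.
move=> /negP /notin_dual [A AD]; rewrite chi_line => h; exists A => //.
by move: h; case: (_ (+) _).
Qed.

Lemma notin_pair i j : i != j -> exists2 A, A \in D & (i \in A) (+) (j \in A).
Proof.
rewrite -sep14 => /notin_dual [A AD]; rewrite chi_symdl !chi1l => h.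
by exists A => //; move: h; case: (i \in A) (j \in A) => [] [].
Qed.

Lemma in_some_word i : exists2 A, A \in D & i \in A.
Proof.
case: card_doubly_even14 => _ /(_ i) /notin_dual [A AD]; rewrite chi1l => h.
by exists A => //; move: h; case: (i \in A).
Qed.

Lemma neq_of_word i j A : (i \in A) (+) (j \in A) -> i != j.
Proof. by apply: contraTneq => ->; rewrite addbb. Qed.

(** Tells apart two of the seven points of [heptad] by a word A of C0 containing
    exactly one of them; mem expresses membership in A of the seven points in
    terms of three of them. *)
Ltac separate mem A AD H :=
  apply: (@neq_of_word _ _ A); rewrite ?(mem _ AD); move: H;
  by do 3? case: (_ \in A).

(** Let {i0, a, a'} and {i0, b, b'} be two lines through i0, c the third letter of
    the line through a and b, and c' that of the line through i0 and c. In terms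
    of columns a' = i0 + a, b' = i0 + b, c = a + b and c' = i0 + a + b, so these
    are the seven points of a Fano plane. The required words are sums of two
    lines. *)
Lemma heptad i0 : exists L : seq 'I_14,
  [/\ uniq L, size L = 7%N, {subset L <= i0 |: nbr i0} &
      {in [:: [:: 1; 2; 3; 4]; [:: 1; 2; 5; 6]; [:: 1; 3; 5; 7]]%N,
        forall g, word L g \in C}].
Proof.
have /card_gt0P [a /nbrP [a' l1]] : (0 < #|nbr i0|)%N by rewrite card_nbr.
have [b /nbrP [b' l2] /norP [ba ba']] :
    exists2 b, b \in nbr i0 & ~~ ((b == a) || (b == a')).
  have : ~~ (nbr i0 \subset [:: a; a']).
    apply/negP => /subset_leq_card /leq_trans /(_ (card_size _)).
    by rewrite card_nbr.
  by case/subsetPn => b bi; rewrite !inE => ?; exists b.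
have [l1c l1d l1e] := line_perm l1; have [l2c l2d l2e] := line_perm l2.
have ai : a \in nbr i0 by apply/nbrP; exists a'.
have bi : b \in nbr i0 by apply/nbrP; exists b'.
have /nbrP [c l3] : b \in nbr a.
  by apply: (nbr_trans (j := i0)) => //; rewrite nbr_sym.
have [l3c l3d l3e] := line_perm l3.
have ci : c != i0.
  by apply: contraNneq ba' => e; rewrite e in l3c; rewrite (line_uniq l1d l3c).
have ca : c \in nbr a by apply/nbrP; exists b.
have cn : c \in nbr i0 by apply: (nbr_trans ai).
have /nbrP [c' l4] := cn; have [l4c l4d l4e] := line_perm l4.
(* Each nonzero combination of the columns i0, a and b is nonzero at a word. *)
have [A1 D1 H1] := in_some_word i0; have [A2 D2 H2] := in_some_word a.
have [A3 D3 H3] := in_some_word b.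
have [A4 D4 H4] := notin_pair (line_neq l1).
have [A5 D5 H5] := notin_pair (line_neq l2).
have [A6 D6 H6] := notin_pair (line_neq l3).
have [A7 D7 H7] : exists2 A, A \in D & (i0 \in A) (+) (a \in A) (+) (b \in A).
  by apply: notin_line => /(line_uniq l1) e; rewrite e eqxx in ba'.
have m1 := line_mem l1; have m2 := line_mem l2; have m3 := line_mem l3.
have m4 := line_mem l4.
have mem A AD := (@m4 A AD, @m3 A AD, @m2 A AD, @m1 A AD).
pose L := [:: a; a'; b; b'; c'; c; i0].
have uL : uniq L.
  rewrite /= !inE !negb_or /= !andbT.
  by repeat (apply/andP; split);
    first [ separate mem A1 D1 H1 | separate mem A2 D2 H2 | separate mem A3 D3 H3
          | separate mem A4 D4 H4 | separate mem A5 D5 H5 | separate mem A6 D6 H6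
          | separate mem A7 D7 H7 ].
have um m : uniq (mask m L) by apply: mask_uniq.
exists L; split=> //.
  move=> x; rewrite !inE => /or4P [|||/or4P []] /eqP ->; rewrite ?eqxx ?orbT //;
    apply/orP; right; apply/existsP; eexists; eassumption.
move=> g; rewrite !in_cons in_nil orbF.
case/or3P => /eqP ->; rewrite /word /=; apply: word_dual14 => //;
  try by [exact: (um [:: true; true; true; true])
         |exact: (um [:: true; true; false; false; true; true])
         |exact: (um [:: true; false; true; false; true; false; true])].
all: move=> A AD; rewrite !big_cons big_nil !chi1l !(mem _ AD).
all: by case: (i0 \in A) (a \in A) (b \in A) => [] [] [].
Qed.

Lemma labelling14 : exists L : seq 'I_14,
  [/\ uniq L, size L = 14%N & {in gens14, forall g, word L g \in C}].
Proof.
have [L1 [u1 s1 sub1 w1]] := heptad ord0.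
have [i2 ni2] : exists i2, i2 \notin ord0 |: nbr ord0.
  have /subsetPn [i2 _ ni2] : ~~ ([set: 'I_14] \subset ord0 |: nbr ord0).
    apply/negP => /subset_leq_card; rewrite cardsT card_ord cardsU1 card_nbr.
    by case: (_ \notin _).
  by exists i2.
have [L2 [u2 s2 sub2 w2]] := heptad i2.
have u12 : uniq (L1 ++ L2).
  rewrite cat_uniq u1 u2 andbT; apply/hasPn => x /sub2; rewrite !in_setU1 => x2.
  apply/negP => /sub1; rewrite in_setU1 => x1; case/negP: ni2; rewrite in_setU1.
  have [//|i20] := eqVneq i2 ord0.
  case/orP: x1 x2 => [/eqP ->|x1] /orP [/eqP e|x2].
  - by rewrite e eqxx in i20.
  - by rewrite nbr_sym.
  - by rewrite -e.
  - by apply: (nbr_trans x1) => //; rewrite nbr_sym.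
exists (L1 ++ L2); split=> //; first by rewrite size_cat s1 s2.
have LT : [set x in L1 ++ L2] = setT.
  apply/eqP; rewrite eqEcard subsetT cardsT card_ord cardsE (card_uniqP u12).
  by rewrite size_cat s1 s2.
case: L1 s1 w1 u1 u12 LT {sub1} =>
  [|? [|? [|? [|? [|? [|? [|? [|? ?]]]]]]]] // _ w1 _ _ LT.
case: L2 s2 w2 u2 LT {sub2} =>
  [|? [|? [|? [|? [|? [|? [|? [|? ?]]]]]]]] // _ w2 _ LT.
move=> g; rewrite !in_cons in_nil orbF.
case/or4P => [|||/or4P []] /eqP ->.
- by rewrite /word /= LT.
- exact: (w1 [:: 1; 2; 3; 4]%N).
- exact: (w1 [:: 1; 2; 5; 6]%N).
- exact: (w1 [:: 1; 3; 5; 7]%N).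
- exact: (w2 [:: 1; 2; 3; 4]%N).
- exact: (w2 [:: 1; 2; 5; 6]%N).
- exact: (w2 [:: 1; 3; 5; 7]%N).
Qed.
End Length14.

(** * Words orthogonal to the generators *)

Definition letters n (g : seq nat) : {set 'I_n} := [set i : 'I_n | i.+1 \in g].

Definition addb_seq (s t : seq bool) : seq bool := [seq x.1 (+) x.2 | x <- zip s t].

Definition bits n (g : seq nat) : seq bool := mkseq (fun k => k.+1 \in g) n.

Definition span_bits n (gens : seq (seq nat)) : seq (seq bool) :=
  foldr (fun g S => S ++ map (addb_seq (bits n g)) S) [:: nseq n false] gens.

Definition all_bits n : seq (seq bool) :=
  iter n (fun S => map (cons true) S ++ map (cons false) S) [:: [::]].

Definition orthogonal_bits (g : seq nat) (s : seq bool) : bool :=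
  ~~ odd (count (fun k => nth false s k.-1) g).

(** The second half says, in terms of vectors of bits, that the code spanned by
    the generators contains its dual. The test uses a conditional and not an
    implication so that evaluation looks up the span only when needed. *)
Definition dual_in_span n (gens : seq (seq nat)) : bool :=
  all (fun g => uniq g && all (fun k => 0 < k <= n)%N g) gens &&
  all (fun s => if all (orthogonal_bits^~ s) gens then s \in span_bits n gens
                else true)
    (all_bits n).

Lemma gens12_dual_in_span : dual_in_span 12 gens12.
Proof. by vm_compute. Qed.

Lemma gens14_dual_in_span : dual_in_span 14 gens14.
Proof. by vm_compute. Qed.

Section Span.
Context {n : nat}.
Implicit Types (A : {set 'I_n.+1}) (g : seq nat) (s : seq bool).

Lemma lettersE g : all (fun k => 0 < k <= n.+1)%N g ->
  letters n.+1 g = [set x in [seq inord k.-1 | k <- g]].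
Proof.
move=> /allP gn; apply/setP => i; rewrite !in_set.
apply/idP/mapP => [ig|[k kg ->]].
  by exists i.+1 => //=; rewrite inord_val.
by have := gn k kg => /andP [k0 kn]; rewrite inordK prednK.
Qed.

Lemma uniq_letters g : uniq g -> all (fun k => 0 < k <= n.+1)%N g ->
  uniq [seq inord k.-1 : 'I_n.+1 | k <- g].
Proof.
move=> ug /allP gn; rewrite map_inj_in_uniq // => k l /gn /andP [k0 kn] /gn /andP [l0 ln].
by move=> /(congr1 val); rewrite /= !inordK ?prednK //; lia.
Qed.

Let bits_of A : seq bool := [seq i \in A | i <- enum 'I_n.+1].

Lemma nth_bits_of A (i : 'I_n.+1) : nth false (bits_of A) i = (i \in A).
Proof. by rewrite (nth_map i) ?size_enum_ord // nth_ord_enum. Qed.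

Lemma mem_all_bits s : s \in all_bits (size s).
Proof.
elim: s => [|b s IHs] //=; rewrite mem_cat.
by case: b; rewrite map_f ?orbT.
Qed.

Lemma chi_letters A g : uniq g -> all (fun k => 0 < k <= n.+1)%N g ->
  chi (letters n.+1 g) A = if orthogonal_bits g (bits_of A) then 1 else -1.
Proof.
move=> ug gn; rewrite lettersE // chi_word ?uniq_letters // big_map.
transitivity ((-1) ^+ count (fun k => nth false (bits_of A) k.-1) g : int).
  elim: g {ug} gn => [|k g IHg] /=; first by rewrite big_nil.
  move=> /andP [/andP [k0 kn] gn]; rewrite big_cons IHg // exprD chi1l.
  by rewrite -nth_bits_of inordK // prednK.
by rewrite -signr_odd /orthogonal_bits; case: odd.
Qed.

Lemma dual_in_span_word (gens : seq (seq nat)) (Q : {set 'I_n.+1} -> Prop) A :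
    dual_in_span n.+1 gens -> Q set0 -> (forall A B, Q A -> Q B -> Q (symd A B)) ->
    {in gens, forall g, Q (letters n.+1 g)} ->
    {in gens, forall g, chi (letters n.+1 g) A = 1} -> Q A.
Proof.
move=> /andP [/allP wf /allP sd] Q0 QD Qg A1.
have szA : size (bits_of A) = n.+1 by rewrite size_map size_enum_ord.
have := sd (bits_of A); rewrite -{1}szA => /(_ (mem_all_bits _)).
rewrite (_ : all _ gens); last first.
  apply/allP => g gg; have /andP [ug gn] := wf g gg.
  by have := A1 g gg; rewrite chi_letters //; case: ifP.
pose set_of s := [set i : 'I_n.+1 | nth false s i].
rewrite [in X in _ -> X](_ : A = set_of (bits_of A)); last first.
  by apply/setP => i; rewrite in_set nth_bits_of.
suff sub : forall (gs : seq (seq nat)) s, {subset gs <= gens} ->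
    s \in span_bits n.+1 gs -> size s = n.+1 /\ Q (set_of s).
  by move=> sA; have [] := sub gens _ (fun _ => id) sA.
move=> gs; elim: gs => [|g gs IHgs] s sg /=.
  rewrite inE -[false :: _]/(nseq n.+1 false) => /eqP ->; rewrite size_nseq; split=> //.
  have -> : set_of (nseq n.+1 false) = set0; last by [].
  by apply/setP => i; rewrite !inE nth_nseq if_same.
have sgs : {subset gs <= gens} by move=> h hgs; apply: sg; rewrite inE hgs orbT.
rewrite mem_cat => /orP [/IHgs|/mapP [t /IHgs]]; first exact.
move=> /(_ sgs) [szt Qt] ->; split.
  by rewrite size_map size_zip size_mkseq szt minnn.
suff -> : set_of (addb_seq (bits n.+1 g) t) = symd (letters n.+1 g) (set_of t).
  by apply: QD => //; apply: Qg; apply: sg; apply: mem_head.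
apply/setP => i; rewrite !in_set (nth_map (false, false)); last first.
  by rewrite size_zip size_mkseq szt minnn.
by rewrite nth_zip ?size_mkseq ?szt //= nth_mkseq.
Qed.

End Span.

From mathcomp Require Import all_classical all_reals all_analysis.
Import numFieldNormedType.Exports.
Local Open Scope classical_set_scope.

(** * The Clifford algebra: monomials and vectors *)

Section Clifford.
Context {R : realType} {n : nat}.
Implicit Types (A B : {set 'I_n}) (i j : 'I_n) (u v : 'rV[R]_n) (x y : cliff R n).
Local Notation e A := (cliff_mono R A).
Local Notation vec := (@cliff_vec R n).

Lemma cliff_sign_pm A B : exists b : bool, cliff_sign R A B = (-1) ^+ b.
Proof.
rewrite /cliff_sign; elim/big_rec: _ => [|i x _ [b ->]]; first by exists false.
suff [c ->] : exists c : bool, \prod_(j in B | (j <= i)%N) (-1) = (-1) ^+ c :> R.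
  by exists (c (+) b); rewrite signr_addb.
elim/big_rec: _ => [|j y _ [c ->]]; first by exists false.
by exists (~~ c); rewrite signrN mulN1r.
Qed.

Lemma cliff_sign_comm A B :
  cliff_sign R A B * cliff_sign R B A = (-1) ^+ (#|A| * #|B| + #|A :&: B|).
Proof.
rewrite /cliff_sign; under eq_bigr do rewrite big_mkcondr.
under [X in _ * X]eq_bigr do rewrite big_mkcondr.
rewrite [X in _ * X]exchange_big -big_split /=.
rewrite (eq_bigr (fun i => (-1) ^+ #|B| * (-1) ^+ (i \in B))) => [|i _].
  rewrite big_split /= prodr_const -exprM mulnC exprD; congr (_ * _).
  rewrite (big_setID B) /= [X in _ * X]big1 ?mulr1 => [|i].
    rewrite (eq_bigr (fun=> -1)) ?prodr_const // => i.
    by rewrite inE => /andP [_ ->].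
  by rewrite inE => /andP [/negbTE ->].
rewrite -big_split /= -prodr_const.
have -> : (-1) ^+ (i \in B) = \prod_(j in B) (if j == i then -1 else 1) :> R.
  have [iB|iB] := boolP (i \in B).
    by rewrite (bigD1 i) //= eqxx big1 ?mulr1 // => j /andP [_ /negbTE ->].
  by rewrite big1 // => j jB; case: eqVneq iB => // <-; rewrite jB.
rewrite -big_split; apply: eq_bigr => j _ /=; rewrite -val_eqE /=.
by case: ltngtP; rewrite ?mulr1 ?mul1r.
Qed.

Lemma cliff_mono_comm A B :
  e A * e B = (-1) ^+ (#|A| * #|B| + #|A :&: B|) *: (e B * e A).
Proof.
rewrite !cliff_monoM symdC scalerA -cliff_sign_comm -mulrA; congr (_ *: _).
have [b ->] := cliff_sign_pm B A.
by rewrite -expr2 sqrr_sign mulr1.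
Qed.

Lemma cliff_mono1 : e finset.set0 = 1 :> cliff R n. Proof. by []. Qed.

Lemma cliff_mono_sq A : exists b : bool, e A * e A = (-1) ^+ b.
Proof.
have [b eb] := cliff_sign_pm A A; exists b; rewrite cliff_monoM eb.
have -> : symd A A = finset.set0 by apply/setP => i; rewrite !inE addbb.
by rewrite cliff_mono1 scaler_sign; case: b {eb}; rewrite ?expr1.
Qed.

Lemma cliff_mono_unit A : e A \is a GRing.unit.
Proof.
have [b eb] := cliff_mono_sq A; apply/unitrP; exists ((-1) ^+ b * e A).
have l : (-1) ^+ b * e A * e A = 1 by rewrite -mulrA eb -expr2 sqrr_sign.
by split=> //; rewrite mulrA (commr_sign (e A)).
Qed.

Lemma cliff_sum (x : cliff R n) : x = \sum_A cliff_coef A x *: e A.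
Proof.
apply: cliffP => B; rewrite /cliff_coef sum_ffunE (bigD1 B) //= big1 => [|A AB].
  by rewrite !ffunE eqxx addr0; apply/esym/mulr1.
by rewrite !ffunE eq_sym (negbTE AB); apply/mulr0.
Qed.

Lemma cliff_coef_sum (I : Type) (r : seq I) (P : pred I) (F : I -> cliff R n) A :
  cliff_coef A (\sum_(i <- r | P i) F i) = \sum_(i <- r | P i) cliff_coef A (F i).
Proof. by rewrite /cliff_coef sum_ffunE. Qed.

Lemma cliff_vecD u v : vec (u + v) = vec u + vec v.
Proof. by rewrite -big_split; apply: eq_bigr => i _; rewrite mxE scalerDl. Qed.

Lemma cliff_vecZ (a : R) v : vec (a *: v) = a *: vec v.
Proof. by rewrite scaler_sumr; apply: eq_bigr => i _; rewrite mxE scalerA. Qed.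

Lemma cliff_vecN v : vec (- v) = - vec v.
Proof. by rewrite -scaleN1r cliff_vecZ scaleN1r. Qed.

Lemma cliff_vec_delta i : vec (delta_mx ord0 i) = cliff_gen R i.
Proof.
rewrite /cliff_vec (bigD1 i) //= mxE !eqxx scale1r big1 ?addr0 // => j ji.
by rewrite mxE (negbTE ji) andbF scale0r.
Qed.

Lemma cliff_coef_vec i v : cliff_coef [set i]%SET (vec v) = v ord0 i.
Proof.
rewrite cliff_coef_sum (bigD1 i) //= big1 => [|j ji].
  by rewrite cliff_coefZ cliff_coef_mono eqxx mulr1 addr0.
rewrite cliff_coefZ cliff_coef_mono; case: eqP => [/set1_inj e|]; last by rewrite mulr0.
by rewrite e eqxx in ji.
Qed.

Lemma cliff_vec_inj : injective vec.
Proof.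
move=> u v e; apply/rowP => i.
by rewrite -(cliff_coef_vec i u) e cliff_coef_vec.
Qed.

Definition dot u v : R := \sum_i u ord0 i * v ord0 i.

Lemma dotE u v : (u *m v^T) ord0 ord0 = dot u v.
Proof. by rewrite mxE; apply: eq_bigr => i _; rewrite mxE. Qed.

Lemma is_unit_vecE v : is_unit_vec v <-> dot v v = 1.
Proof. by rewrite /is_unit_vec /dot; under eq_bigr do rewrite expr2. Qed.

Lemma cliff_vecM_sum u v : vec u * vec v =
  \sum_i \sum_j (u ord0 i * v ord0 j) *: (cliff_gen R i * cliff_gen R j).
Proof.
rewrite {1}/cliff_vec mulr_suml; apply: eq_bigr => i _; rewrite mulr_sumr.
by apply: eq_bigr => j _; rewrite -scalerAl -scalerAr scalerA.
Qed.

(** The Clifford relations, polarized. *)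
Lemma cliff_vecM u v : vec u * vec v + vec v * vec u = - (2 * dot u v)%:A.
Proof.
have gg i j : cliff_gen R i * cliff_gen R j + cliff_gen R j * cliff_gen R i =
    (if i == j then - 2 else 0)%:A :> cliff R n.
  case: eqVneq => [->|ij]; last by rewrite cliff_gen_anticomm // addNr scale0r.
  by rewrite cliff_gen_sqr -opprD scaleNr -mulr2n scaler_nat.
rewrite cliff_vecM_sum [vec v * _]cliff_vecM_sum [X in _ + X]exchange_big.
rewrite -big_split /= mulr_sumr -scaleNr -sumrN scaler_suml.
apply: eq_bigr => i _; rewrite -big_split /= (bigD1 i) //= big1 => [|j ji].
  rewrite [v _ _ * _]mulrC -scalerDr gg eqxx addr0.
  by rewrite scalerA; congr (_ *: _); rewrite mulrN mulrC.
rewrite [v _ _ * _]mulrC -scalerDr gg eq_sym.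
by rewrite (negbTE ji) scale0r scaler0.
Qed.

Lemma cliff_vec_sq v : vec v * vec v = - (dot v v)%:A.
Proof.
have := cliff_vecM v v; rewrite -mulr2n -scaler_nat -scaleNr -mulrN -scalerA.
by rewrite scaleNr => /scalerI; apply; rewrite pnatr_eq0.
Qed.

End Clifford.

(** * Versors, the spin group, and orthonormal frames *)

Section Versors.
Context {R : realType} {n : nat}.
Implicit Types (i j : 'I_n) (u v : 'rV[R]_n) (x y g : cliff R n) (M N : 'M[R]_n).
Local Notation vec := (@cliff_vec R n).

Definition is_versor x : Prop := exists2 vs : seq 'rV[R]_n,
  forall v, v \in vs -> is_unit_vec v & x = \prod_(v <- vs) cliff_vec v.

(** Stated without inverse, which makes it multiplicative in x with no hypothesis. *)
Definition acts x M : Prop := forall v, x * vec v = vec (v *m M) * x.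

Definition orthogonal_mx M : Prop := M *m M^T = 1%:M.

Lemma is_unit_vecN v : is_unit_vec v -> is_unit_vec (- v).
Proof. by rewrite /is_unit_vec; under [in X in _ -> X]eq_bigr do rewrite mxE sqrrN. Qed.

Lemma unit_vec_sq v : is_unit_vec v -> vec v * vec v = -1.
Proof. by move=> /is_unit_vecE v1; rewrite cliff_vec_sq v1 scale1r. Qed.

Lemma invr_eq x y : x * y = 1 -> y * x = 1 -> x \is a GRing.unit /\ x^-1 = y.
Proof.
move=> xy yx; have ux : x \is a GRing.unit by apply/unitrP; exists y.
by split=> //; rewrite -[RHS](mulKr ux) xy mulr1.
Qed.

Lemma unit_vec_inv v : is_unit_vec v ->
  vec v \is a GRing.unit /\ (vec v)^-1 = vec (- v).
Proof.
by move=> v1; apply: invr_eq; rewrite cliff_vecN ?mulrN ?mulNr unit_vec_sq // opprK.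
Qed.

Lemma is_versor1 : is_versor 1.
Proof. by exists [::]; rewrite ?big_nil. Qed.

Lemma is_versor_vec v : is_unit_vec v -> is_versor (vec v).
Proof.
by move=> v1; exists [:: v]; rewrite ?big_seq1 // => u; rewrite inE => /eqP ->.
Qed.

Lemma is_versorM x y : is_versor x -> is_versor y -> is_versor (x * y).
Proof.
move=> [us u1 ->] [vs v1 ->]; exists (us ++ vs); last by rewrite big_cat.
by move=> v; rewrite mem_cat => /orP [/u1|/v1].
Qed.

Lemma versor_inv (vs : seq 'rV[R]_n) : (forall v, v \in vs -> is_unit_vec v) ->
  let x := \prod_(v <- vs) vec v in
  x \is a GRing.unit /\ x^-1 = \prod_(v <- rev [seq - v | v <- vs]) vec v.
Proof.
elim: vs => [|v vs IHvs] v1 /=; first by rewrite !big_nil unitr1 invr1.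
have [|ux ex] := IHvs; first by move=> u uvs; apply: v1; rewrite inE uvs orbT.
have [uv ev] := unit_vec_inv (v1 v (mem_head _ _)).
by rewrite rev_cons -cats1 big_cat big_seq1 big_cons unitrMr // invrM // ex ev.
Qed.

Lemma versor_unit x : is_versor x -> x \is a GRing.unit.
Proof. by move=> [vs v1 ->]; case: (versor_inv v1). Qed.

Lemma Spin_versor x : Spin R n x -> is_versor x.
Proof. by move=> [vs [_ v1 ->]]; exists vs. Qed.

Lemma Spin_unit x : Spin R n x -> x \is a GRing.unit.
Proof. by move=> /Spin_versor /versor_unit. Qed.

Lemma Spin1 : Spin R n 1.
Proof. by exists [::]; rewrite big_nil. Qed.

Lemma SpinM x y : Spin R n x -> Spin R n y -> Spin R n (x * y).
Proof.
move=> [us [ou u1 ->]] [vs [ov v1 ->]]; exists (us ++ vs); split.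
- by rewrite size_cat oddD (negbTE ou).
- by move=> v; rewrite mem_cat => /orP [/u1|/v1].
- by rewrite big_cat.
Qed.

Lemma SpinV x : Spin R n x -> Spin R n x^-1.
Proof.
move=> [vs [ov v1 ->]]; have [_ ->] := versor_inv v1.
exists (rev [seq - v | v <- vs]); split=> //; first by rewrite size_rev size_map.
by move=> v; rewrite mem_rev => /mapP [u /v1 u1 ->]; apply: is_unit_vecN.
Qed.

Lemma Spin_vec2 u v : is_unit_vec u -> is_unit_vec v -> Spin R n (vec u * vec v).
Proof.
move=> u1 v1; exists [:: u; v]; split=> //; last by rewrite big_cons big_seq1.
by move=> w; rewrite !inE => /orP [/eqP ->|/eqP ->].
Qed.

Lemma versor_Spin x : is_versor x ->
  Spin R n x \/ forall u, is_unit_vec u -> Spin R n (x * vec u).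
Proof.
move=> [vs v1 ->]; have [ov|ov] := boolP (odd (size vs)).
  right=> u u1; exists (rcons vs u); split; rewrite ?size_rcons ?negbK //.
    by move=> v; rewrite mem_rcons inE => /orP [/eqP ->|/v1].
  by rewrite -cats1 big_cat big_seq1.
by left; exists vs.
Qed.

Lemma dotC u v : dot u v = dot v u.
Proof. by apply: eq_bigr => i _; rewrite mulrC. Qed.

Lemma dot_orthogonal M u v : orthogonal_mx M -> dot (u *m M) (v *m M) = dot u v.
Proof. by move=> oM; rewrite -!dotE trmx_mul mulmxA -(mulmxA u) oM mulmx1. Qed.

Lemma dotBl u v w : dot (u - v) w = dot u w - dot v w.
Proof. by rewrite /dot -sumrB; apply: eq_bigr => i _; rewrite !mxE mulrBl. Qed.

Lemma dotZl (a : R) u v : dot (a *: u) v = a * dot u v.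
Proof. by rewrite /dot mulr_sumr; apply: eq_bigr => i _; rewrite mxE mulrA. Qed.

Lemma dotZr (a : R) u v : dot u (a *: v) = a * dot u v.
Proof. by rewrite dotC dotZl dotC. Qed.

Lemma dot_deltar u i : dot u (delta_mx ord0 i) = u ord0 i.
Proof.
rewrite /dot (bigD1 i) //= mxE !eqxx mulr1 big1 ?addr0 // => j ji.
by rewrite mxE (negbTE ji) andbF mulr0.
Qed.

Lemma dot_delta i j : dot (delta_mx ord0 i) (delta_mx ord0 j) = (i == j)%:R :> R.
Proof. by rewrite dot_deltar mxE eqxx eq_sym. Qed.

Lemma dot_gt0 u : u != 0 -> 0 < dot u u.
Proof.
move=> u0; rewrite lt_def; apply/andP; split; last first.
  by apply: sumr_ge0 => i _; rewrite -expr2 sqr_ge0.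
apply: contraNneq u0 => /eqP; rewrite psumr_eq0; last first.
  by move=> i _; rewrite -expr2 sqr_ge0.
move=> /allP h; apply/eqP/rowP => i; rewrite mxE.
by have := h i (mem_index_enum _); rewrite mulf_eq0 orbb => /eqP.
Qed.

(** A unit vector u acts by minus the reflection in u, whose matrix is
    2 u^T u - 1. *)
Lemma acts_versor x : is_versor x -> exists2 M, orthogonal_mx M & acts x M.
Proof.
move=> [vs v1 ->]; elim: vs v1 => [|u vs IHvs] v1.
  exists 1%:M; first by rewrite /orthogonal_mx trmx1 mul1mx.
  by move=> v; rewrite big_nil mulmx1 mul1r mulr1.
have [|M oM aM] := IHvs; first by move=> v vvs; apply: v1; rewrite inE vvs orbT.
have /is_unit_vecE u1 := v1 u (mem_head _ _).
have uu : u *m u^T = 1%:M.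
  by rewrite [LHS]mx11_scalar dotE u1.
pose N := 2 *: (u^T *m u) - 1%:M.
have sN : N^T = N by rewrite linearB linearZ /= trmx_mul trmxK trmx1.
exists (M *m N).
  rewrite /orthogonal_mx trmx_mul mulmxA -(mulmxA M) sN.
  suff -> : N *m N = 1%:M by rewrite mulmx1.
  have uuuu : (u^T *m u) *m (u^T *m u) = u^T *m u.
    by rewrite mulmxA -(mulmxA u^T) uu mulmx1.
  rewrite /N mulmxBl mul1mx mulmxBr mulmx1 -scalemxAl -scalemxAr uuuu scalerA.
  rewrite opprB addrA addrAC -[_ - _ - _]addrA -opprD -!scalerDl -scalerBl.
  by rewrite (_ : _ - _ = 0) ?scale0r ?add0r //; ring.
have aN v : vec u * vec v = vec (v *m N) * vec u.
  have -> : v *m N = (2 * dot u v) *: u - v.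
    rewrite mulmxBr mulmx1 -scalemxAr mulmxA [v *m u^T]mx11_scalar dotE mul_scalar_mx.
    by rewrite scalerA dotC.
  rewrite cliff_vecD cliff_vecN cliff_vecZ mulrDl mulNr -scalerAl cliff_vec_sq u1.
  by rewrite scale1r scalerN -cliff_vecM addrK.
move=> v; rewrite big_cons -mulrA aM mulrA aN -mulrA.
by rewrite -mulmxA.
Qed.

(** This is the argument of Cartan and Dieudonne. When g already sends e_i to
    b_i up to sign for i < k, let u be the vector that g sends to b_k. Unless
    u = e_k, replace g by g w, where w is the unit vector along u - e_k:
    conjugation by w sends e_k to -u, and changes the sign of the previous
    vectors, which are orthogonal to both u and e_k. *)
Lemma versor_frame (b : 'I_n -> 'rV[R]_n) :
    (forall i j, dot (b i) (b j) = (i == j)%:R) ->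
  exists2 g, is_versor g &
    forall i, exists s : bool, g * cliff_gen R i = (-1) ^+ s *: (vec (b i) * g).
Proof.
move=> ob.
suff frame k : (k <= n)%N -> exists2 g, is_versor g & forall i, (i < k)%N ->
    exists s : bool, g * cliff_gen R i = (-1) ^+ s *: (vec (b i) * g).
  by have [g vg gP] := frame n (leqnn n); exists g => // i; apply: gP.
elim: k => [_|k IHk kn]; first by exists 1 => //; apply: is_versor1.
have [g vg gP] := IHk (ltnW kn); pose i0 := Ordinal kn.
have [M oM aM] := acts_versor vg; pose u := b i0 *m M^T.
have oMt : M^T *m M = 1%:M by apply: mulmx1C.
have uM : u *m M = b i0 by rewrite -mulmxA oMt mulmx1.
have gu : vec (b i0) * g = g * vec u by rewrite aM uM.
have u1 : dot u u = 1 by rewrite -(dot_orthogonal _ _ oM) uM ob eqxx.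
have ue i : (i < k)%N -> dot u (delta_mx ord0 i) = 0.
  move=> ik; have [s gs] := gP i ik.
  have : delta_mx ord0 i *m M = (-1) ^+ s *: b i.
    apply: cliff_vec_inj; apply: (mulIr (versor_unit vg)).
    by rewrite -aM cliff_vec_delta gs cliff_vecZ scalerAl.
  rewrite -(dot_orthogonal _ _ oM) uM => ->; rewrite dotZr ob.
  by rewrite -val_eqE /= gtn_eqF // mulr0.
have last_step g' : is_versor g' ->
    (forall i, (i < k)%N ->
      exists s : bool, g' * cliff_gen R i = (-1) ^+ s *: (vec (b i) * g')) ->
    (exists s : bool, g' * cliff_gen R i0 = (-1) ^+ s *: (vec (b i0) * g')) ->
    exists2 g, is_versor g & forall i, (i < k.+1)%N ->
    exists s : bool, g * cliff_gen R i = (-1) ^+ s *: (vec (b i) * g).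
  move=> vg' g'P g'0; exists g' => // i; rewrite ltnS leq_eqVlt.
  move=> /predU1P [ik|]; last exact: g'P.
  by have -> : i = i0 by apply: val_inj.
have [ue0|ue0] := eqVneq u (delta_mx ord0 i0).
  apply: (last_step g) => //; exists false.
  by rewrite scale1r gu ue0 cliff_vec_delta.
pose d := u - delta_mx ord0 i0; have d0 : 0 < dot d d by rewrite dot_gt0 // subr_eq0.
pose a := (Num.sqrt (dot d d))^-1; pose w := a *: d.
have w1 : is_unit_vec w.
  apply/is_unit_vecE; rewrite dotZl dotZr mulrA -expr2 exprVn sqr_sqrtr ?ltW //.
  by rewrite mulVf // gt_eqF.
apply: (last_step (g * vec w)).
- by apply: is_versorM => //; apply: is_versor_vec.
- move=> i ik; have [s gs] := gP i ik; exists (~~ s).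
  have : vec w * cliff_gen R i = - (cliff_gen R i * vec w).
    apply/eqP; rewrite -addr_eq0 -cliff_vec_delta cliff_vecM dotZl dotBl ue //.
    by rewrite dot_delta -val_eqE /= gtn_eqF // subrr !mulr0 scale0r oppr0.
  rewrite -mulrA => ->; rewrite mulrN [g * (_ * _)]mulrA gs -scalerAl -mulrA.
  by case: s {gs}; rewrite /= ?expr1 ?expr0 ?scaleN1r ?scale1r ?opprK.
- exists true; rewrite expr1 scaleN1r mulrA gu -!mulrA -mulrN; congr (g * _).
  apply/eqP; rewrite -addr_eq0 -cliff_vec_delta cliff_vecZ cliff_vecD cliff_vecN.
  rewrite -scalerAl -scalerAr -scalerDr mulrBl mulrBr addrC addrA subrK.
  by rewrite !cliff_vec_sq u1 dot_delta eqxx subrr scaler0.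
Qed.

(** An odd versor is corrected by a factor e_i0, which only affects signs. *)
Lemma Spin_frame (b : 'I_n -> 'rV[R]_n) :
    (forall i j, dot (b i) (b j) = (i == j)%:R) ->
  exists2 g, Spin R n g &
    forall i, exists s : bool, g * cliff_gen R i = (-1) ^+ s *: (vec (b i) * g).
Proof.
move=> ob; have [g vg gP] := versor_frame ob.
have [sg|sg] := versor_Spin vg; first by exists g.
have [i0 _|no] := pickP (@predT 'I_n); last first.
  by exists 1; [exact: Spin1|move=> j; have := no j].
have e1 : is_unit_vec (delta_mx ord0 i0 : 'rV[R]_n).
  by apply/is_unit_vecE; rewrite dot_delta eqxx.
exists (g * vec (delta_mx ord0 i0)); first exact: sg.
move=> i; have [s gs] := gP i; exists (s (+) (i != i0)).
have c : cliff_gen R i0 * cliff_gen R i =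
    (-1) ^+ (i != i0) *: (cliff_gen R i * cliff_gen R i0).
  case: eqVneq => [->|ii0]; first by rewrite scale1r.
  by rewrite expr1 scaleN1r cliff_gen_anticomm // eq_sym.
rewrite cliff_vec_delta -mulrA c -scalerAr [g * (_ * _)]mulrA gs -scalerAl scalerA -!mulrA.
by rewrite signr_addb mulrC.
Qed.

End Versors.

(** * Lie algebras of finite subgroups and of the spin group *)

Section LieAlgebra.
Context {R : realType} {n : nat}.
Implicit Types (i j : 'I_n) (X Y : cliff R n) (F G : set (cliff R n)).
Local Notation vec := (@cliff_vec R n).

(** The finitely many other values stay away from h 0, so by continuity h is
    constant near 0. *)
Lemma is_derive_finite_range (h : R -> R) (d : R) :
  finite_set (range h) -> is_derive (0 : R) (1 : R) h d -> d = 0.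
Proof.
move=> fh dh; have [dv _] := dh.
have ch : {for 0, continuous h}.
  by apply: differentiable_continuous; apply/derivable1_diffP.
pose K := range h `\ h 0.
have cK : closed K.
  have /accessible_finite_set_closed : accessible_space R.
    by apply: hausdorff_accessible; exact: norm_hausdorff.
  by apply; exact: finite_setD.
have oK : nbhs (h 0) (~` K).
  by apply: open_nbhs_nbhs; split; [exact: closed_openC | move=> [_]; apply].
have nh : \forall t \near (0 : R), h t = cst (h 0) t.
  near=> t; have : (~` K) (h t) by near: t; exact: (ch _ oK).
  move=> /= ht; apply: contrapT => ne; apply: ht.
  by split; [exists t | exact: ne].
have d0 : is_derive (0 : R) (1 : R) (cst (h 0)) d by apply: near_eq_is_derive nh dh.
by case: d0 => _ <-; case: (is_derive_cst (h 0) (0 : R) (1 : R)).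
Unshelve. all: by end_near.
Qed.

Lemma lie_algebra_finite F X : finite_set F -> lie_algebra F X -> X = 0.
Proof.
move=> fF [g [g0 Fg dg]]; apply: cliffP => A.
rewrite (is_derive_finite_range _ (dg A)); first by rewrite /cliff_coef ffunE.
apply: (@sub_finite_set _ _ ((cliff_coef A) @` F)); last exact: finite_image.
by move=> _ [t _ <-]; exists (g t).
Qed.

Lemma is_derive_bigsum (I : Type) (r : seq I) (h : I -> R -> R) (dh : I -> R) :
  (forall k, is_derive (0 : R) (1 : R) (h k) (dh k)) ->
  is_derive (0 : R) (1 : R) (fun t => \sum_(k <- r) h k t) (\sum_(k <- r) dh k).
Proof.
move=> hd; elim: r => [|k r IHr].
  by rewrite big_nil; under eq_fun do rewrite big_nil; exact: is_derive_cst.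
rewrite big_cons; under eq_fun do rewrite big_cons.
exact: is_deriveD.
Qed.

(** The velocities of two curves through 1 add up in the product curve. *)
Lemma lie_algebraD G X Y : (forall x y, G x -> G y -> G (x * y)) ->
  lie_algebra G X -> lie_algebra G Y -> lie_algebra G (X + Y).
Proof.
move=> GM [f [f0 Gf df]] [g [g0 Gg dg]]; exists (fun t => f t * g t); split.
- by rewrite f0 g0 mulr1.
- by move=> t; apply: GM.
move=> C; under eq_fun do rewrite cliff_coef_mul.
have -> : cliff_coef C (X + Y) = \sum_A cliff_sign R A (symd A C) *
   (cliff_coef A (f 0) * cliff_coef (symd A C) Y +
    cliff_coef (symd A C) (g 0) * cliff_coef A X).
  rewrite f0 g0 -[X in X + Y]mulr1 -[Y in _ + Y]mul1r cliff_coefD !cliff_coef_mul.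
  rewrite addrC -big_split; apply: eq_bigr => A _; rewrite mulrDr; congr (_ + _).
  by rewrite [_ * cliff_coef A X]mulrC.
apply: is_derive_bigsum => A.
have dM := is_deriveM (df A) (dg (symd A C)).
exact: (is_deriveZ (cliff_sign R A (symd A C)) dM).
Qed.

(** The curve is t |-> cos(at) + sin(at) e_i e_j, the product of the unit vectors
    e_i and -cos(at) e_i + sin(at) e_j. *)
Lemma lie_algebra_Spin_bivector (a : R) i j : i != j ->
  lie_algebra (Spin R n) (a *: (cliff_gen R i * cliff_gen R j)).
Proof.
move=> ij; set ee := cliff_gen R i * cliff_gen R j.
exists (fun t => cos (a * t) *: 1 + sin (a * t) *: ee); split.
- by rewrite mulr0 cos0 sin0 scale1r scale0r addr0.
- move=> t; pose u : 'rV[R]_n := delta_mx ord0 i; pose v : 'rV[R]_n := delta_mx ord0 j.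
  have -> : cos (a * t) *: 1 + sin (a * t) *: ee =
      vec u * vec (- cos (a * t) *: u + sin (a * t) *: v).
    rewrite cliff_vecD !cliff_vecZ mulrDr -!scalerAr !cliff_vec_delta cliff_gen_sqr.
    by rewrite scalerN scaleNr opprK.
  apply: Spin_vec2; apply/is_unit_vecE; first by rewrite dot_delta eqxx.
  rewrite /dot (bigD1 i) //= (bigD1 j) ?(eq_sym j) //= big1 => [|k /andP [ki kj]].
    rewrite !mxE !eqxx (eq_sym j) (negbTE ij) /= !mulr1 !mulr0 addr0 add0r addr0.
    by rewrite -!expr2 sqrrN cos2Dsin2.
  by rewrite !mxE (negbTE ki) (negbTE kj) /= !mulr0 addr0 mul0r.
move=> A; pose c1 := cliff_coef A (1 : cliff R n); pose c2 := cliff_coef A ee.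
rewrite cliff_coefZ -/c2.
under eq_fun do rewrite cliff_coefD !cliff_coefZ -/c1 -/c2.
have dl : is_derive (0 : R) (1 : R) (fun t => a * t) a.
  apply: is_derive_eq (is_deriveZ a (is_derive_id (0 : R) (1 : R))) _.
  exact: mulr1.
have dc := is_derive1_comp (is_derive_cos (a * 0)) dl.
have ds := is_derive1_comp (is_derive_sin (a * 0)) dl.
have d := is_deriveD (is_deriveZ c1 dc) (is_deriveZ c2 ds).
under eq_fun do rewrite mulrC [sin _ * _]mulrC.
apply: is_derive_eq d _.
by rewrite mulr0 sin0 cos0 oppr0 mul0r scaler0 add0r mul1r; exact: mulrC.
Qed.
End LieAlgebra.

(** * Fixed bivectors and simultaneous diagonalization *)

Section Bivectors.
Context {R : realType} {n : nat}.
Implicit Types (i j : 'I_n) (f g : cliff R n) (M N S : 'M[R]_n) (F : set (cliff R n)).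
Local Notation vec := (@cliff_vec R n).

Definition bivector S : cliff R n :=
  \sum_i \sum_j S i j *: (cliff_gen R i * cliff_gen R j).

Lemma bivector_acts f M S : acts f M ->
  f * bivector S = bivector (M^T *m S *m M) * f.
Proof.
move=> aM; pose ee i j : cliff R n := cliff_gen R i * cliff_gen R j.
have fee i j : f * ee i j = (\sum_k \sum_l (M i k * M j l) *: ee k l) * f.
  rewrite /ee -!cliff_vec_delta mulrA aM -mulrA aM mulrA -!rowE cliff_vecM_sum.
  by under eq_bigr do under eq_bigr do rewrite !mxE.
rewrite mulr_sumr; under eq_bigr do rewrite mulr_sumr.
under eq_bigr do under eq_bigr do rewrite -scalerAr fee scalerAl scaler_sumr.
under eq_bigr do rewrite -mulr_suml.
rewrite -mulr_suml; congr (_ * f).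
under eq_bigr do rewrite exchange_big.
rewrite exchange_big; apply: eq_bigr => k _ /=.
under eq_bigr do under eq_bigr do rewrite scaler_sumr.
under eq_bigr do rewrite exchange_big.
rewrite exchange_big; apply: eq_bigr => l _ /=.
under eq_bigr do under eq_bigr do rewrite scalerA.
under eq_bigr do rewrite -scaler_suml.
rewrite -scaler_suml; congr (_ *: _).
rewrite exchange_big mxE; apply: eq_bigr => j _ /=.
rewrite mxE mulr_suml; apply: eq_bigr => i _.
by rewrite mxE mulrA [M i k * _]mulrC.
Qed.

Lemma lie_algebra_Spin0 : lie_algebra (Spin R n) 0.
Proof.
exists (fun=> 1); split=> // [t|A]; first exact: Spin1.
by rewrite [X in is_derive _ _ _ X]ffunE; exact: is_derive_cst.
Qed.

Lemma lie_algebra_bivector S : (forall i, S i i = 0) ->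
  lie_algebra (Spin R n) (bivector S).
Proof.
move=> S0; apply: big_ind => [||i _]; first exact: lie_algebra_Spin0.
  by move=> X Y; apply: lie_algebraD => x y; exact: SpinM.
apply: big_ind => [||j _]; first exact: lie_algebra_Spin0.
  by move=> X Y; apply: lie_algebraD => x y; exact: SpinM.
have [->|ij] := eqVneq i j; last exact: lie_algebra_Spin_bivector.
by rewrite S0 scale0r; exact: lie_algebra_Spin0.
Qed.

(** Only the terms e_i e_j and e_j e_i = -e_i e_j contribute to this coordinate. *)
Lemma cliff_coef_bivector S i j : i != j ->
  cliff_coef [set i; j]%SET (bivector S) =
  cliff_sign R [set i]%SET [set j]%SET * (S i j - S j i).
Proof.
move=> ij; have symd1 k l : k != l -> symd [set k]%SET [set l]%SET = [set k; l]%SET.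
  move=> kl; apply/setP => x; rewrite !inE.
  by case: (eqVneq x k) => [->|]; rewrite ?(negbTE kl).
have ee k l : cliff_coef [set i; j]%SET (cliff_gen R k * cliff_gen R l) =
   cliff_sign R [set k]%SET [set l]%SET * ([set i; j] == symd [set k] [set l])%SET%:R.
  by rewrite cliff_monoM cliff_coefZ cliff_coef_mono.
rewrite cliff_coef_sum; under eq_bigr do rewrite cliff_coef_sum.
under eq_bigr do under eq_bigr do rewrite cliff_coefZ ee.
have ji : j != i by rewrite eq_sym.
rewrite (bigD1 i) //= (bigD1 j) //= [X in _ + X](bigD1 j) //=.
rewrite [X in _ + (X + _)](bigD1 i) //=.
rewrite !symd1 // eqxx [[set j; i]%SET]finset.setUC eqxx !mulr1.
rewrite big1 => [|l lj]; last first.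
  case: eqP => [e|_]; last by rewrite !mulr0.
  have : j \in symd [set i]%SET [set l]%SET by rewrite -e !inE eqxx orbT.
  by rewrite !inE (negbTE ji) [j == l]eq_sym (negbTE lj).
rewrite big1 => [|l li]; last first.
  case: eqP => [e|_]; last by rewrite !mulr0.
  have : i \in symd [set j]%SET [set l]%SET by rewrite -e !inE eqxx.
  by rewrite !inE (negbTE ij) [i == l]eq_sym (negbTE li).
rewrite big1 => [|k /andP [ki kj]]; last first.
  rewrite big1 // => l _; case: eqP => [e|_]; last by rewrite !mulr0.
  have : k \in [set i; j]%SET.
    rewrite e !inE eqxx /=; case: eqVneq => // kl.
    have : i \in symd [set k]%SET [set l]%SET by rewrite -e !inE eqxx.
    by rewrite -kl !inE addbb.
  by rewrite !inE (negbTE ki) (negbTE kj).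
rewrite !addr0 mulrBr [S i j * _]mulrC; congr (_ + _).
rewrite !cliff_sign11 mulrC -mulNr; congr (_ * _).
by have := ij; rewrite -val_eqE /=; case: ltngtP; rewrite ?opprK.
Qed.

Lemma bivector_eq0 S : S^T = - S -> bivector S = 0 -> S = 0.
Proof.
move=> aS S0; have aSE i j : S j i = - S i j.
  by have := congr1 (fun N : 'M[R]_n => N i j) aS; rewrite !mxE.
apply/matrixP => i j; rewrite mxE; have [->|ij] := eqVneq i j.
  by have := aSE j j; lra.
have := cliff_coef_bivector S ij; rewrite S0 (aSE i j) opprK [LHS]ffunE.
move/esym/eqP; rewrite mulf_eq0 => /orP [|/eqP]; last by lra.
by have [b ->] := @cliff_sign_pm R n [set i]%SET [set j]%SET; rewrite signr_eq0.
Qed.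

Lemma condition_star_finite F X : finite_set F -> condition_star (Spin R n) F ->
  lie_fixed (Spin R n) F X -> X = 0.
Proof.
move=> fF [U [W [eU eW dUW]]] fX.
have XU : X \in U by have : [set` U] X by rewrite eU.
have W0 : W = 0%VS.
  apply/eqP; rewrite -subv0; apply/subvP => Y YW.
  have : lie_algebra F Y by rewrite -eW.
  by move=> /(lie_algebra_finite fF) ->; rewrite mem0v.
have U0 : U = 0%VS by apply/eqP; rewrite -dimv_eq0 dUW W0 dimv0.
by move: XU; rewrite U0 memv0 => /eqP.
Qed.

(** The bivector of S lies in the Lie algebra of the spin group and inherits the
    invariance of S under F, so condition star makes it vanish. *)
Lemma antisym_fixed F S : finite_set F -> F `<=` Spin R n ->
  condition_star (Spin R n) F -> S^T = - S ->
  (forall f, F f -> exists2 M, acts f M & M^T *m S *m M = S) -> S = 0.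
Proof.
move=> fF sF cF aS fS; apply: bivector_eq0 => //.
apply: (condition_star_finite fF cF); split=> [|f Ff].
  apply: lie_algebra_bivector => i.
  by have := congr1 (fun N : 'M[R]_n => N i i) aS; rewrite !mxE; lra.
have [M aM SM] := fS f Ff; rewrite (bivector_acts _ aM) SM.
by rewrite mulrK //; apply: Spin_unit; apply: sF.
Qed.

Lemma acts_uniq f M N : f \is a GRing.unit -> acts f M -> acts f N -> M = N.
Proof.
move=> uf aM aN; apply/row_matrixP => i; rewrite !rowE; apply: cliff_vec_inj.
by apply: (mulIr uf); rewrite -aM aN.
Qed.

Lemma actsM f g M N : acts f M -> acts g N -> acts (f * g) (N *m M).
Proof. by move=> aM aN v; rewrite -mulrA aN mulrA aM -mulrA mulmxA. Qed.

End Bivectors.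

Section Diagonalization.
Context {R : realType} {m : nat}.
Local Notation n := m.+1.
Implicit Types (i j : 'I_n) (f g : cliff R n) (M N S : 'M[R]_n) (F : set (cliff R n)).
Local Notation vec := (@cliff_vec R n).

Lemma involution_diagonalizable M : M *m M = 1%:M -> diagonalizable M.
Proof.
move=> MM; apply/diagonalizableP; exists [:: 1; -1].
  by rewrite /= inE andbT; apply/eqP; lra.
apply: mxminpoly_min; rewrite big_cons big_seq1 rmorphM rmorphB rmorphB /=.
rewrite !horner_mx_X !horner_mx_C raddfN opprK -[1%:M]/(1 : 'M[R]_n).
rewrite mulrDr mulr1 mulrBl mul1r addrA subrK.
by rewrite -[M * M]/(M *m M) MM subrr.
Qed.

(** The basis comes from the simultaneous diagonalization of commuting
    diagonalizable matrices; its vectors need only be normalized, because common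
    eigenvectors with distinct systems of signs are orthogonal. *)
Lemma simultaneous_eigenframe F : finite_set F -> is_subgroup (Spin R n) F ->
    is_abelian F -> condition_star (Spin R n) F ->
  exists (b : 'I_n -> 'rV[R]_n) (s : cliff R n -> 'I_n -> bool),
    [/\ forall i j, dot (b i) (b j) = (i == j)%:R,
        forall f i, F f -> f * vec (b i) = (-1) ^+ s f i *: (vec (b i) * f) &
        forall i j, i != j -> exists2 f, F f & s f i != s f j].
Proof.
move=> fF [sF _ _ _] abF cF.
have [rho rhoP] : {rho : cliff R n -> 'M[R]_n & forall f, F f ->
    orthogonal_mx (rho f) /\ acts f (rho f)}.
  apply: (@choice _ _ (fun (f : cliff R n) (M : 'M[R]_n) =>
    F f -> orthogonal_mx M /\ acts f M)) => f.
  have [Ff|nF] := pselect (F f); last by exists 0.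
  by have [M oM aM] := acts_versor (Spin_versor (sF _ Ff)); exists M.
have oT f : F f -> (rho f)^T *m rho f = 1%:M by move=> /rhoP [oM _]; apply: mulmx1C.
have comm f g : F f -> F g -> rho f *m rho g = rho g *m rho f.
  move=> Ff Fg; apply: (acts_uniq (f := g * f)).
  - by rewrite unitrMr; apply: Spin_unit; apply: sF.
  - by apply: actsM; [case: (rhoP g Fg)|case: (rhoP f Ff)].
  - by rewrite (abF _ _ Fg Ff); apply: actsM; [case: (rhoP f Ff)|case: (rhoP g Fg)].
have sym f : F f -> (rho f)^T = rho f.
  move=> Ff; apply/eqP; rewrite eq_sym -subr_eq0; apply/eqP.
  apply: (antisym_fixed fF sF cF); first by rewrite linearB /= trmxK opprB.
  move=> g Fg; exists (rho g); first by case: (rhoP g Fg).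
  have inv : (rho g)^T *m rho f *m rho g = rho f.
    by rewrite -mulmxA comm // mulmxA oT // mul1mx.
  rewrite mulmxBr mulmxBl inv -[in X in _ - X](trmxK (rho g)) -!trmx_mul.
  by rewrite mulmxA trmxK inv.
have invol f : F f -> rho f *m rho f = 1%:M.
  by move=> Ff; rewrite -{2}sym //; case: (rhoP f Ff).
have /finite_seqP [fs eF] := fF.
have inF f : f \in fs -> F f by rewrite eF.
have [P uP dP] : codiagonalizable [seq rho f | f <- fs].
  apply/codiagonalizableP; split=> [_ _ /mapP [f /inF Ff ->] /mapP [g /inF Fg ->]|].
    exact: comm.
  by move=> _ /mapP [f /inF Ff ->]; apply: involution_diagonalizable; apply: invol.
have [d dE] : {d : cliff R n -> 'rV[R]_n & forall f, F f ->
    P *m rho f = diag_mx (d f) *m P}.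
  apply: (@choice _ _ (fun (f : cliff R n) (D : 'rV[R]_n) =>
    F f -> P *m rho f = diag_mx D *m P)) => f.
  have [Ff|nF] := pselect (F f); last by exists 0.
  have /(allP dP) /similar_diagPex [D /(similarP uP)] : rho f \in map rho fs.
    by apply: map_f; move: Ff; rewrite eF.
  by exists D.
have d2 f i : F f -> d f ord0 i ^+ 2 = 1.
  move=> Ff; have : diag_mx (d f) *m diag_mx (d f) = 1%:M.
    apply: (can_inj (mulmxK uP)); rewrite -mulmxA -dE // mulmxA -dE // -mulmxA.
    by rewrite invol // mulmx1 mul1mx.
  rewrite mulmx_diag => /matrixP /(_ i i); rewrite !mxE eqxx expr2.
  by [].
pose s f i := d f ord0 i == -1.
have dsE f i : F f -> d f ord0 i = (-1) ^+ s f i.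
  move=> Ff; have /eqP := d2 f i Ff; rewrite sqrf_eq1 /s => /orP [] /eqP ->.
    by rewrite (_ : 1 == -1 :> R = false) //; apply/eqP; lra.
  by rewrite eqxx.
have sep i j : i != j -> exists2 f, F f & s f i != s f j.
  move=> ij; apply: contrapT => ns.
  have same f : F f -> d f ord0 i * d f ord0 j = 1.
    move=> Ff; rewrite !dsE //; have [->|ne] := eqVneq (s f i) (s f j).
      by rewrite -expr2 sqrr_sign.
    by case: ns; exists f.
  (* P^T E P commutes with every f, the rows i and j of P having equal signs. *)
  pose E : 'M[R]_n := delta_mx i j - delta_mx j i.
  have dEd f : F f -> diag_mx (d f) *m E *m diag_mx (d f) = E.
    move=> Ff; apply/matrixP => k l; rewrite mul_mx_diag mxE mul_diag_mx !mxE.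
    set dk := d f _ k; set dl := d f _ l.
    have x1 : ((k == i) && (l == j))%:R * (dk * dl) = ((k == i) && (l == j))%:R.
      by case: andP => [[/eqP ei /eqP ej]|_]; rewrite ?mul0r // mul1r /dk /dl ei ej same.
    have y1 : ((k == j) && (l == i))%:R * (dk * dl) = ((k == j) && (l == i))%:R.
      case: andP => [[/eqP ei /eqP ej]|_]; rewrite ?mul0r // mul1r /dk /dl ei ej.
      by rewrite mulrC same.
    by rewrite -[in RHS]x1 -[in RHS]y1; ring.
  have E0 : P^T *m E *m P = 0.
    apply: (antisym_fixed fF sF cF).
      by rewrite !trmx_mul trmxK linearB /= !trmx_delta -mulmxA -opprB mulNmx mulmxN.
    move=> f Ff; exists (rho f); first by case: (rhoP f Ff).
    rewrite !mulmxA -(mulmxA _ P) dE // -trmx_mul dE // trmx_mul tr_diag_mx.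
    by rewrite -[in RHS](dEd f Ff) !mulmxA.
  have : E = invmx P^T *m (P^T *m E *m P) *m invmx P.
    by rewrite -mulmxA mulmxK // mulmxA mulVmx ?unitmx_tr // mul1mx.
  rewrite E0 mulmx0 mul0mx => /matrixP /(_ i j).
  by rewrite !mxE !eqxx (negbTE ij) subr0 => /eqP; rewrite oner_eq0.
(* The Gram matrix of the eigenbasis is diagonal. *)
pose G := P *m P^T.
have G0 i j : i != j -> G i j = 0.
  move=> ij; have [f Ff sij] := sep i j ij.
  have e : diag_mx (d f) *m G = G *m diag_mx (d f).
    by rewrite mulmxA -dE // -!mulmxA -tr_diag_mx -trmx_mul -dE // trmx_mul sym.
  have := congr1 (fun N : 'M[R]_n => N i j) e.
  rewrite mul_diag_mx mul_mx_diag !mxE !dsE // => h.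
  by move: h sij; case: (s f i) (s f j) => [] [] //=; rewrite ?expr0 ?expr1; lra.
have Gdot i j : G i j = dot (row i P) (row j P).
  by rewrite [LHS]mxE; apply: eq_bigr => k _; rewrite !mxE.
have Gpos i : 0 < G i i.
  rewrite Gdot; apply: dot_gt0; apply/eqP => r0.
  have := mulmxK uP (delta_mx ord0 i : 'rV[R]_n); rewrite -rowE r0 mul0mx.
  by move=> /rowP /(_ i); rewrite !mxE !eqxx => /esym /eqP; rewrite oner_eq0.
exists (fun i => (Num.sqrt (G i i))^-1 *: row i P), s; split=> //.
- move=> i j; rewrite dotZl dotZr -Gdot; have [<-|ij] := eqVneq i j.
    rewrite mulrA -invfM -expr2 sqr_sqrtr ?ltW // mulVf ?gt_eqF //.
  by rewrite (G0 i j) // !mulr0.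
- move=> f i Ff; have [_ ->] := rhoP f Ff.
  rewrite -scalemxAl -row_mul dE // row_mul row_diag_mx -scalemxAl -rowE dsE //.
  by rewrite scalerA mulrC -scalerA cliff_vecZ scalerAl.
Qed.
End Diagonalization.

(** * Subgroups of signed monomials *)

Section Monomials.
Context {R : realType} {m : nat}.
Local Notation n := m.+1.
Implicit Types (i j : 'I_n) (A B : {set 'I_n}) (x y f g : cliff R n).
Implicit Types (F G : set (cliff R n)).
Local Notation vec := (@cliff_vec R n).
Local Notation e A := (cliff_mono R A).
Local Notation top := [set: 'I_n]%SET.

Lemma is_subgroupM G F x y : is_subgroup G F -> F x -> F y -> F (x * y).
Proof. by case=> _ _ FM _; apply: FM. Qed.

Lemma subgroup_sign G F (b : bool) x : is_subgroup G F -> F (-1) -> F x ->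
  F ((-1) ^+ b *: x).
Proof.
move=> gF F1 Fx; case: b; rewrite ?expr1 ?scale1r // scaleN1r -mulN1r.
exact: is_subgroupM gF F1 Fx.
Qed.

Lemma signZ (b : bool) x : (-1) ^+ b *: ((-1) ^+ b *: x) = x.
Proof. by rewrite scalerA -expr2 sqrr_sign scale1r. Qed.

(** For each B the monomial e_B commutes with e_A up to a sign, and an element
    with sign t only involves monomials with the same sign. *)
Lemma mono_comm_support A x (t : bool) :
    x * e A = (-1) ^+ t *: (e A * x) ->
  forall B, cliff_coef B x != 0 -> odd (#|B| * #|A| + #|B :&: A|) = t.
Proof.
move=> xA B xB; pose c B' : R := (-1) ^+ (#|B'| * #|A| + #|B' :&: A|) - (-1) ^+ t.
have : e A * \sum_B' (c B' * cliff_coef B' x) *: e B' = 0.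
  move/eqP: xA; rewrite -subr_eq0 {1}(cliff_sum x) [in X in _ - X](cliff_sum x).
  rewrite mulr_suml !mulr_sumr scaler_sumr -sumrB => /eqP e0; rewrite -[RHS]e0.
  apply: eq_bigr => B' _; rewrite -!scalerAr -scalerAl (cliff_mono_comm B' A).
  rewrite !scalerA -scalerBl.
  by congr (_ *: _); rewrite /c; ring.
move=> /(congr1 (fun y => (e A)^-1 * y)); rewrite mulr0 mulKr ?cliff_mono_unit //.
move=> /(congr1 (cliff_coef B)); rewrite cliff_coef_sum (bigD1 B) //= big1 => [|B' BB'].
  rewrite cliff_coefZ cliff_coef_mono eqxx mulr1 addr0 [RHS]ffunE => /eqP.
  rewrite mulf_eq0 (negbTE xB) orbF /c -signr_odd subr_eq0.
  by case: (odd _) (t) => [] [] //; rewrite ?expr0 ?expr1 => /eqP; lra.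
by rewrite cliff_coefZ cliff_coef_mono eq_sym (negbTE BB') mulr0.
Qed.

Lemma cards_setI1 A i : #|A :&: [set i]|%SET = (i \in A).
Proof.
case: (boolP (i \in A)) => iA.
  by rewrite (finset.setIidPr _) ?cards1 // finset.sub1set.
by apply/eqP; rewrite cards_eq0 finset.setI_eq0 disjoint_sym disjoints1.
Qed.

Lemma mono_comm_gen A i :
  e A * cliff_gen R i = (-1) ^+ (#|A| + (i \in A)) *: (cliff_gen R i * e A).
Proof.
by rewrite cliff_mono_comm cards1 muln1 cards_setI1.
Qed.

(** In even dimension the product of all the e_i anticommutes with every vector. *)
Lemma Spin_comm_top x : ~~ odd n -> Spin R n x -> x * e top = e top * x.
Proof.
move=> en [vs [ov _ ->]].
have vT v : vec v * e top = - (e top * vec v).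
  rewrite mulr_suml mulr_sumr -sumrN; apply: eq_bigr => i _.
  rewrite -scalerAl -scalerAr -scalerN mono_comm_gen cardsT card_ord finset.in_setT.
  by rewrite -signr_odd oddD (negbTE en) expr1 scaleN1r opprK.
suff : \prod_(v <- vs) vec v * e top =
    (-1) ^+ size vs *: (e top * \prod_(v <- vs) vec v).
  by rewrite -signr_odd (negbTE ov) scale1r.
elim: vs {ov} => [|v vs IHvs]; first by rewrite big_nil mul1r mulr1 scale1r.
rewrite big_cons -mulrA IHvs -scalerAr [vec v * (_ * _)]mulrA vT mulNr -mulrA exprS mulN1r.
by rewrite scaleNr scalerN.
Qed.

Lemma even_mono_Spin A : ~~ odd n -> Spin R n (e A) -> ~~ odd #|A|.
Proof.
move=> en /(Spin_comm_top en) c.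
have := @mono_comm_support top (e A) false; rewrite scale1r => /(_ c A).
rewrite cliff_coef_mono eqxx oner_eq0 => /(_ isT).
by rewrite cardsT card_ord finset.setIT oddD oddM (negbTE en) andbF /= => ->.
Qed.

Lemma finite_order F x : finite_set F -> is_subgroup (Spin R n) F -> F x ->
  exists2 k, (0 < k)%N & x ^+ k = 1.
Proof.
move=> /finite_seqP [fs eF] gF Fx; have [sF F1 FM _] := gF.
have Fk k : F (x ^+ k) by elim: k => [|k IHk]; rewrite ?expr0 // exprS; apply: FM.
have ux : x \is a GRing.unit by apply: Spin_unit; apply: sF.
pose h (k : 'I_(size fs).+1) := x ^+ k.
have : ~~ injectiveb h.
  apply/injectiveP => inj_h.
  have : (size (codom h) <= size fs)%N.
    apply: uniq_leq_size; first by rewrite /codom /image_mem map_inj_uniq ?enum_uniq.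
    by move=> y /codomP [k ->]; have := Fk k; rewrite eF.
  by rewrite size_codom card_ord ltnn.
move=> /injectivePn [k [l kl hkl]].
wlog lt_kl : k l kl hkl / (k < l)%N.
  move=> W; have := kl; rewrite -val_eqE neq_ltn => /orP [|lt]; first exact: W.
  by apply: (W l k) => //; rewrite eq_sym.
exists (l - k)%N; first by rewrite subn_gt0.
by apply: (mulrI (unitrX k ux)); rewrite mulr1 -exprD subnKC ?(ltnW lt_kl).
Qed.

(** Up to sign, the square of e_A is 1, so some power of a is 1 or -1. *)
Lemma finite_order_mono A (a : R) k : (0 < k)%N -> (a *: e A) ^+ k = 1 ->
  exists b : bool, a = (-1) ^+ b.
Proof.
move=> k0 ak; have [b eb] := @cliff_mono_sq R n A.
have a1 : `|a| = 1.
  have : (a *: e A) ^+ (2 * k) = 1 by rewrite mulnC exprM ak expr1n.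
  rewrite exprM expr2 -scalerAl -scalerAr scalerA eb exprZn -expr2 -exprM -exprM.
  move=> /(congr1 (cliff_coef finset.set0)); rewrite cliff_coefZ -signr_odd.
  rewrite -[1]cliff_mono1 cliff_coef_mono eqxx => /(congr1 Num.norm).
  have [c ->] : exists c : bool,
      (-1) ^+ odd (b * k) = (-1) ^+ c *: e finset.set0 :> cliff R n.
    by exists (odd (b * k)); case: odd; rewrite ?scaleN1r ?scale1r ?expr1.
  rewrite cliff_coefZ cliff_coef_mono eqxx mulr1 normrM normr_sign mulr1 normr1 normrX.
  by move/eqP; rewrite pexpr_eq1 ?muln_gt0 // => /eqP.
by exists (a < 0); rewrite [LHS]numEsign a1 mulr1.
Qed.

Definition mono_group (C : {set {set 'I_n}}) : set (cliff R n) :=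
  [set x | exists A, exists b : bool, A \in C /\ x = (-1) ^+ b *: e A].

(** After conjugation to an eigenframe, each element commutes up to a sign with
    every e_i. The signs determine the monomials that occur in it, and only one
    of them has even weight; its coefficient is a real number of finite order. *)
Lemma conj_mono_group F : ~~ odd n -> finite_set F -> is_subgroup (Spin R n) F ->
    is_abelian F -> condition_star (Spin R n) F -> F (-1) -> F (e top) ->
  exists2 g, Spin R n g & exists2 C, projective_code C &
    [set g^-1 * x * g | x in F] = mono_group C.
Proof.
move=> en fF gF abF cF FN1 Ftop.
have [sF F1 FM FV] := gF.
have [b [s [ob bs sep]]] := simultaneous_eigenframe fF gF abF cF.
have [g sg gb] := Spin_frame ob; have ug := Spin_unit sg.
pose cj x := g^-1 * x * g.
have cjM x y : cj (x * y) = cj x * cj y by rewrite /cj !mulrA mulrK.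
have cjZ (a : R) x : cj (a *: x) = a *: cj x by rewrite /cj -scalerAr -scalerAl.
have cj1 : cj 1 = 1 by rewrite /cj mulr1 mulVr.
have cjs f i : F f -> cj f * cliff_gen R i = (-1) ^+ s f i *: (cliff_gen R i * cj f).
  move=> Ff; have [c gc] := gb i.
  have gc' : g^-1 * vec (b i) = (-1) ^+ c *: (cliff_gen R i * g^-1).
    apply: (mulIr ug); rewrite -scalerAl -mulrA -[in RHS]mulrA mulVr // mulr1.
    apply: (mulrI ug); rewrite mulVKr // -scalerAr gc.
    by rewrite signZ.
  rewrite /cj -(mulrA (g^-1 * f)) gc -scalerAr (mulrA (g^-1 * f) (vec (b i)) g).
  rewrite -(mulrA g^-1 f (vec (b i))) bs //.
  rewrite -scalerAr -!scalerAl (mulrA g^-1) gc' -!scalerAl !scalerA.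
  by rewrite mulrCA -expr2 sqrr_sign mulr1 !mulrA.
have cjmono f : F f -> exists A, exists b : bool, cj f = (-1) ^+ b *: e A.
  move=> Ff; have Sf : Spin R n (cj f).
    by apply: SpinM => //; apply: SpinM; [exact: SpinV|exact: sF].
  have cjf0 : cj f != 0.
    by apply: contraTneq (Spin_unit Sf) => ->; rewrite unitr0.
  (* For |B| even, the sign between e_B and e_i is -1 exactly when i is in B. *)
  pose A := [set i | s f i]%SET.
  have supp B : cliff_coef B (cj f) != 0 -> B = A.
    move=> fB.
    have eB : ~~ odd #|B|.
      have := @mono_comm_support top (cj f) false; rewrite scale1r.
      move=> /(_ (Spin_comm_top en Sf) B fB).
      by rewrite cardsT card_ord finset.setIT oddD oddM (negbTE en) andbF /= => ->.
    apply/setP => i; rewrite inE.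
    have := mono_comm_support (cjs f i Ff) fB.
    rewrite cards1 muln1 oddD (negbTE eB) /= => <-.
    by rewrite cards_setI1 oddb.
  have eA : cj f = cliff_coef A (cj f) *: e A.
    rewrite [LHS]cliff_sum (bigD1 A) //= big1 ?addr0 // => B BA.
    have [->|/supp eB] := eqVneq (cliff_coef B (cj f)) 0; first by rewrite scale0r.
    by rewrite eB eqxx in BA.
  have [k k0 fk] := finite_order fF gF Ff.
  have cjX l : cj f ^+ l = cj (f ^+ l).
    elim: l => [|l IHl]; first by rewrite !expr0 cj1.
    by rewrite !exprS IHl cjM.
  have := finite_order_mono k0 (a := cliff_coef A (cj f)) (A := A).
  rewrite -eA cjX fk => /(_ cj1) [c ec].
  by exists A, c; rewrite eA ec.
pose C := [set A | `[< exists2 f, F f & cj f = e A >]]%SET.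
have CP A : reflect (exists2 f, F f & cj f = e A) (A \in C).
  by rewrite inE; apply: asboolP.
have SC A : A \in C -> ~~ odd #|A|.
  move=> /CP [f Ff ef]; apply: even_mono_Spin en _; rewrite -ef.
  by apply: SpinM => //; apply: SpinM; [exact: SpinV|exact: sF].
exists g => //; exists C; last first.
  apply/seteqP; split=> [_ [f Ff <-]|_ [A [c [/CP [f Ff ef] ->]]]].
    have [A [c ec]] := cjmono f Ff; exists A, c; split=> //.
    apply/CP; exists ((-1) ^+ c *: f); first exact: subgroup_sign gF FN1 Ff.
    by rewrite cjZ ec signZ.
  exists ((-1) ^+ c *: f); first exact: subgroup_sign gF FN1 Ff.
  by rewrite -ef -cjZ.
have cjtop : cj (e top) = e top.
  by rewrite /cj -mulrA -(Spin_comm_top en sg) mulKr.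
split.
- split; first by apply/CP; exists 1.
  move=> A B /CP [f Ff ef] /CP [h Fh eh]; apply/CP.
  have [c ec] := @cliff_sign_pm R n A B.
  exists ((-1) ^+ c *: (f * h)); first exact: subgroup_sign gF FN1 (FM _ _ Ff Fh).
  by rewrite cjZ cjM ef eh cliff_monoM ec signZ.
- by apply/CP; exists (e top).
- apply/fintype.subsetP => A AC; apply/dual_codeP => B BC; rewrite chi_card.
  have [f Ff ef] := CP A AC; have [h Fh eh] := CP B BC.
  have ab : e A * e B = e B * e A by rewrite -ef -eh -!cjM abF.
  have := @mono_comm_support B (e A) false; rewrite scale1r => /(_ ab A).
  rewrite cliff_coef_mono eqxx oner_eq0 oddD oddM (negbTE (SC _ AC)) /= => /(_ isT) oAB.
  by rewrite -signr_odd oAB.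
- move=> i j ij; have [f Ff sij] := sep i j ij.
  have [A [c ec]] := cjmono f Ff.
  have AC : A \in C.
    apply/CP; exists ((-1) ^+ c *: f); first exact: subgroup_sign gF FN1 Ff.
    by rewrite cjZ ec signZ.
  have sA k : s f k = (k \in A).
    have := cjs f k Ff; rewrite ec -scalerAl -scalerAr scalerA mulrC -scalerA.
    move=> /(can_inj (signZ c)) h.
    have := mono_comm_support h (B := A).
    rewrite cliff_coef_mono eqxx oner_eq0 => /(_ isT) <-.
    rewrite cards1 muln1 oddD (negbTE (SC _ AC)) /=.
    by rewrite cards_setI1 oddb.
  apply/negP => /dual_codeP /(_ _ AC); rewrite chi_symdl !chi1l.
  by move: sij; rewrite !sA; case: (i \in A) (j \in A) => [] [].
Qed.

End Monomials.

(** * Conjugation onto the model groups *)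

Section Models.
Context {R : realType} {m : nat}.
Local Notation n := m.+1.
Implicit Types (i j : 'I_n) (A B : {set 'I_n}) (x y h : cliff R n) (g : seq nat).
Implicit Types (F H : set (cliff R n)).
Local Notation e A := (cliff_mono R A).

Lemma prod_gen_mono (s : seq 'I_n) : uniq s -> exists c : bool,
  \prod_(i <- s) cliff_gen R i = (-1) ^+ c *: e [set x in s]%SET.
Proof.
elim: s => [_|i s IHs /= /andP [si us]].
  by exists false; rewrite big_nil scale1r -cliff_mono1; congr cliff_mono.
have [c ec] := IHs us; have [d ed] := @cliff_sign_pm R n [set i]%SET [set x in s]%SET.
exists (c (+) d); rewrite big_cons ec -scalerAr cliff_monoM ed scalerA signr_addb.
congr (_ *: e _); apply/setP => j; rewrite !inE.
by case: eqVneq => [->|//]; rewrite (negbTE si).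
Qed.

Lemma cliff_e_letters (g : seq nat) : uniq g -> all (fun k => 0 < k <= n)%N g ->
  exists c : bool, cliff_e R m g = (-1) ^+ c *: e (letters n g).
Proof.
move=> ug gn; have [c ec] := prod_gen_mono (uniq_letters ug gn).
by exists c; rewrite lettersE // -ec big_map.
Qed.

Lemma conj_prod_gen h (p : 'I_n -> 'I_n) (s : seq 'I_n) :
    (forall i, exists c : bool,
      h * cliff_gen R i = (-1) ^+ c *: (cliff_gen R (p i) * h)) ->
  exists c : bool, h * \prod_(i <- s) cliff_gen R i =
    (-1) ^+ c *: (\prod_(i <- s) cliff_gen R (p i) * h).
Proof.
move=> hp; elim: s => [|i s [d ed]].
  by exists false; rewrite !big_nil mulr1 mul1r scale1r.
have [c ec] := hp i; exists (c (+) d).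
rewrite !big_cons mulrA ec -scalerAl -(mulrA _ h) ed -scalerAr scalerA mulrA.
by rewrite signr_addb.
Qed.

Lemma conj_mono h (p : 'I_n -> 'I_n) A : injective p ->
    (forall i, exists c : bool,
      h * cliff_gen R i = (-1) ^+ c *: (cliff_gen R (p i) * h)) ->
  exists c : bool, h * e A = (-1) ^+ c *: (e (p @: A)%SET * h).
Proof.
move=> ip hp; have [c ec] := conj_prod_gen (enum A) hp.
have up : uniq (map p (enum A)) by rewrite map_inj_uniq ?enum_uniq.
have [d ed] := prod_gen_mono up.
rewrite big_map in ed; exists (c (+) d); rewrite cliff_mono_prod ec ed.
rewrite -scalerAl scalerA signr_addb; congr (_ *: (e _ * h)).
apply/setP => i; rewrite inE; apply/mapP/imsetP => -[j jA ->]; exists j => //.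
  by rewrite mem_enum in jA.
by rewrite mem_enum.
Qed.

Lemma chi_imset (p : 'I_n -> 'I_n) A B : injective p ->
  chi (p @: A)%SET (p @: B)%SET = chi A B.
Proof.
move=> ip; rewrite !chi_card -finset.imsetI ?card_imset // => i j _ _.
exact: ip.
Qed.

Lemma letters_word (L : seq 'I_n) (p : 'I_n -> 'I_n) (g : seq nat) :
    (forall i : 'I_n, p i = nth ord0 L i) -> all (fun k => 0 < k <= n)%N g ->
  (p @: letters n g)%SET = word L g.
Proof.
move=> pL gn; rewrite lettersE //; apply/setP => i; rewrite inE.
apply/imsetP/mapP => [[j]|[k kg ->]].
  rewrite inE => /mapP [k kg ->] ->; exists k => //; rewrite pL inordK //.
  by have /andP [k0 kn] := allP gn k kg; rewrite prednK.
exists (inord k.-1); first by rewrite inE; apply/mapP; exists k.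
by rewrite pL inordK //; have /andP [k0 kn] := allP gn k kg; rewrite prednK.
Qed.

Lemma is_subgroup_conj F h : Spin R n h -> is_subgroup (Spin R n) F ->
  is_subgroup (Spin R n) [set h * x * h^-1 | x in F].
Proof.
move=> Sh [sF F1 FM FV]; have uh := Spin_unit Sh.
split=> [_ [x Fx <-]||_ _ [x Fx <-] [y Fy <-]|_ [x Fx <-]].
- by apply: SpinM; [apply: SpinM => //; apply: sF|apply: SpinV].
- by exists 1 => //; rewrite mulr1 mulrV.
- by exists (x * y); [exact: FM|rewrite !mulrA mulrVK].
- exists x^-1; first exact: FV.
  have ux := Spin_unit (sF _ Fx).
  by rewrite !invrM ?unitrV ?unitrMr // invrK mulrA.
Qed.

(** The spin group realizes the permutation of the letters given by the labelling,
    up to signs, so that F becomes a group F' containing the generators of the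
    model. Conversely each monomial of F' is orthogonal to the generators, hence
    belongs to every group containing them. *)
Lemma conjugate_generated (gens : seq (seq nat)) :
    ~~ odd n -> iota 1 n \in gens -> dual_in_span n gens ->
    (forall C : {set {set 'I_n}}, projective_code C -> exists L : seq 'I_n,
       [/\ uniq L, size L = n & {in gens, forall g, word L g \in C}]) ->
  forall F, finite_set F -> is_subgroup (Spin R n) F -> is_abelian F ->
    condition_star (Spin R n) F -> F (-1) -> F (cliff_e R m (iota 1 n)) ->
  conjugate_in (Spin R n) F
    (generated (Spin R n) [set` -1 :: [seq cliff_e R m g | g <- gens]]).
Proof.
move=> en Tg sdg labels F fF gF abF cF FN1 Fc.
have wf g : g \in gens -> uniq g /\ all (fun k => 0 < k <= n)%N g.
  by move=> gg; case/andP: sdg => /allP /(_ g gg) /andP [].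
have Ftop : F (e [set: 'I_n]%SET).
  have [u w] := wf _ Tg; have [c ec] := cliff_e_letters u w.
  have -> : e [set: 'I_n]%SET = (-1) ^+ c *: cliff_e R m (iota 1 n).
    rewrite ec signZ; congr cliff_mono; apply/setP => i.
    by rewrite finset.in_setT finset.in_set mem_iota add1n !ltnS leq_ord.
  exact: subgroup_sign gF FN1 Fc.
have [g1 Sg1 [C pC eF]] := conj_mono_group en fF gF abF cF FN1 Ftop.
have [L [uL sL wL]] := labels C pC.
pose p (i : 'I_n) := nth ord0 L i.
have ip : injective p.
  by move=> i j /eqP; rewrite nth_uniq ?sL // => /eqP /val_inj.
have [g2 Sg2 g2P] : exists2 h, Spin R n h & forall i, exists c : bool,
    h * cliff_gen R i = (-1) ^+ c *: (cliff_gen R (p i) * h).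
  have [|h Sh hP] := @Spin_frame R n (fun i => delta_mx ord0 (p i)).
    by move=> i j; rewrite dot_delta (inj_eq ip).
  by exists h => // i; have [c hc] := hP i; exists c; rewrite hc cliff_vec_delta.
have ug1 := Spin_unit Sg1; have ug2 := Spin_unit Sg2.
have g2V A : exists c : bool, g2^-1 * e (p @: A)%SET * g2 = (-1) ^+ c *: e A.
  have [c hc] := conj_mono A ip g2P; exists c.
  by apply: (mulrI ug2); rewrite -scalerAr hc signZ -mulrA mulVKr.
exists (g2^-1 * g1^-1); first by apply: SpinM; apply: SpinV.
set F' := [set _ * x * _ | x in F].
have gF' : is_subgroup (Spin R n) F'.
  by apply: is_subgroup_conj => //; apply: SpinM; apply: SpinV.
have inv : (g2^-1 * g1^-1)^-1 = g1 * g2 by rewrite invrM ?unitrV // !invrK.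
have F'E : F' = [set g2^-1 * x * g2 | x in mono_group C].
  rewrite -eF; apply/seteqP; split=> [_ [x Fx <-]|_ [_ [x Fx <-] <-]].
    by exists (g1^-1 * x * g1); [exists x|rewrite inv !mulrA].
  by exists x => //; rewrite inv !mulrA.
have F'N1 : F' (-1).
  by exists (-1) => //; rewrite mulrN1 mulNr mulrV // unitrMr ?unitrV.
have letC g : g \in gens -> (p @: letters n g)%SET \in C.
  by move=> gg; have [_ w] := wf g gg; rewrite (@letters_word L) // wL.
apply/seteqP; split; last first.
  apply: smallest_sub => //.
  move=> x /=; rewrite inE => /orP [/eqP -> //|/mapP [g gg ->]].
  have [u w] := wf g gg; have [c ec] := cliff_e_letters u w.
  rewrite ec; apply: (subgroup_sign _ gF' F'N1); have [d ed] := g2V (letters n g).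
  rewrite F'E; exists ((-1) ^+ d *: e (p @: letters n g)%SET).
    by exists (p @: letters n g)%SET, d; split=> //; apply: letC.
  by rewrite -scalerAr -scalerAl ed signZ.
rewrite F'E => _ [_ [A [b [AC ->]]] <-] H [gH HS].

have HN1 : H (-1) by apply: HS; rewrite /= mem_head.
pose A' := (p @^-1: A)%SET.
have pA' : (p @: A')%SET = A.
  apply/setP => i; apply/imsetP/idP => [[j]|iA]; first by rewrite inE => jA ->.
  have [q pq qp] := injF_bij ip.
  by exists (q i); rewrite ?inE qp.
have [c ec] := g2V A'; rewrite pA' in ec.
rewrite -scalerAr -scalerAl ec; apply: (subgroup_sign _ gH HN1).
apply: (subgroup_sign _ gH HN1).
apply: (@dual_in_span_word m gens (fun B => H (e B)) A' sdg).
- by rewrite cliff_mono1; case: gH.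
- move=> B1 B2 H1 H2; have [d ed] := @cliff_sign_pm R n B1 B2.
  rewrite -(signZ d (e (symd B1 B2))) -ed -cliff_monoM ed.
  exact: subgroup_sign gH HN1 (is_subgroupM gH H1 H2).
- move=> g gg; have [u w] := wf g gg; have [d ed] := cliff_e_letters u w.
  rewrite -(signZ d (e (letters n g))) -ed; apply: (subgroup_sign _ gH HN1).
  by apply: HS; rewrite /= inE map_f ?orbT.
- move=> g gg; rewrite -(chi_imset _ _ ip) pA'.
  by have /dual_codeP := projective_sub pC (letC g gg); apply.
Qed.

End Models.

Theorem proposition2p3 (R : realType) :
  (forall F : set (cliff R 12),
     finite_set F -> is_subgroup (Spin R 12) F -> is_abelian F ->
     condition_star (Spin R 12) F ->
     F (-1) -> F (cliff_e R 11 (iota 1 12)) ->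
     conjugate_in (Spin R 12) F (F12 R)) /\
  (forall F : set (cliff R 14),
     finite_set F -> is_subgroup (Spin R 14) F -> is_abelian F ->
     condition_star (Spin R 14) F ->
     F (-1) -> F (cliff_e R 13 (iota 1 14)) ->
     conjugate_in (Spin R 14) F (F14 R)).
Proof.
split.
- apply: (@conjugate_generated R 11 gens12 isT (mem_head _ _) gens12_dual_in_span).
  by move=> C pC; have [_ [B CB DB]] := card_code12 pC; exact: (labelling12 pC CB DB).
- apply: (@conjugate_generated R 13 gens14 isT (mem_head _ _) gens14_dual_in_span).
  by move=> C; apply: labelling14.
Qed.
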